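(* (a) Let $d\ge2$, let $\{V_n\}_{n\ge1}$ be nonempty finite sets with $|V_n|\to\infty$, and let $E_n\subset V_n^d$ be symmetric and non-diagonal sets with $|E_n|\to\infty$. Assume that $\{E_n\}$ has combinatorial dimension $\alpha$ with $1<\alpha\le d$. Then $\{E_n\}$ is irreducible. (b) For every $d\ge3$ and every $b\in\{2,\dots,d-1\}$, there exist nonempty finite sets $V_n$ with $|V_n|\to\infty$ and symmetric, non-diagonal sets $E_n\subset V_n^d$ with $|E_n|\to\infty$, such that $\{E_n\}$ has combinatorial dimension $$\alpha=\frac db\in(1,d),$$ and such that the corresponding sequence of homogeneous sums $$Z_n=\sum_{(v_1,\dots,v_d)\in E_n}X_{v_1}\cdots X_{v_d}$$ satisfies an irreducible CLT.
   Context: $V=\bigcup_nV_n$ and $\{X_v:v\in V\}$ are i.i.d. standard normal random variables. A set $E_n\subset V_n^d$ is symmetric if $(v_1,\dots,v_d)\in E_n$ implies $(v_{\sigma(1)},\dots,v_{\sigma(d)})\in E_n$ for all permutations $\sigma$ of $\{1,\dots,d\}$; it is non-diagonal if $(v_1,\dots,v_d)\in E_n$ implies $v_i\ne v_j$ for all $i\ne j$. Combinatorial dimension: for $\alpha\in(0,d]$, a sequence of sets $J_n\subseteq V_n^d$ has combinatorial dimension $\alpha$ if there exist finite constants $0<c'\le c$ such that, for all $n$ sufficiently large, $|J_n\cap(A_1\times\cdots\times A_d)|\le c\,\max_{i=1,\dots,d}|A_i|^\alpha$ for all $A_1,\dots,A_d\subseteq V_n$, and $|J_n|\ge c'|V_n|^\alpha$.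 Irreducibility: $\{E_n\}$ (equivalently, the associated sequence $\{Z_n\}$) is reducible if for every $n$ there exist pairwise disjoint subsets $B_1,\dots,B_{m_n}\subset V_n$ (depending on $n$) such that, as $n\to\infty$: $m_n\to\infty$; $\sum_{i=1}^{m_n}|E_n\cap B_i^d|\sim|E_n|$; and $\max_{i=1,\dots,m_n}|E_n\cap B_i^d|=o(|E_n|)$. It is irreducible if no such choice exists. $\{Z_n\}$ satisfies an irreducible CLT if it is irreducible and $Z_n/\sqrt{d!\,|E_n|}$ converges in distribution, as $n\to\infty$, to a standard normal random variable. *)

(* Defs.v *)
From HB Require Import structures.
From mathcomp Require Import all_boot all_order all_fingroup all_algebra.
From mathcomp Require Import finmap.
From mathcomp Require Import all_classical all_reals all_analysis.
From mathcomp Require Import measurable_realfun.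

Set Implicit Arguments.
Unset Strict Implicit.
Unset Printing Implicit Defensive.

Import Order.TTheory GRing.Theory Num.Theory.
Import numFieldNormedType.Exports.

Local Open Scope fset_scope.
Local Open Scope classical_set_scope.
Local Open Scope ring_scope.

(* The finite sets [V n] and [E n], a subset of the [d]-th power of [V n], are
   finite subsets of [T] and [d.-tuple T] for one ambient type [T], so that the
   union of the [V n] makes sense.  Sequences start at [n = 0]. *)
Section Sets.
Context {T : choiceType} {d : nat}.
Implicit Types (V : {fset T}) (E : {fset d.-tuple T}).

Definition in_power V E : Prop :=
  forall t, t \in E -> forall i, tnth t i \in V.

Definition symmetric_set E : Prop :=
  forall t (s : 'S_d), t \in E -> [tuple tnth t (s i) | i < d] \in E.

Definition non_diagonal E : Prop :=
  forall t, t \in E -> forall i j, i != j -> tnth t i != tnth t j.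

(* intersection of [E] with the product of the [A i] *)
Definition box E (A : 'I_d -> {fset T}) : {fset d.-tuple T} :=
  [fset t in E | [forall i, tnth t i \in A i]].

End Sets.

Section Sequences.
Context (R : realType) {T : choiceType} {d : nat}.
Implicit Types (V : nat -> {fset T}) (E : nat -> {fset d.-tuple T}).

Definition combinatorial_dimension V E (alpha : R) : Prop :=
  0 < alpha <= d%:R /\
  exists c' c : R, 0 < c' <= c /\
    \forall n \near \oo,
      (forall A : 'I_d -> {fset T}, (forall i, A i `<=` V n)%fset ->
         #|` box (E n) A|%:R
           <= c * (\max_(i < d) #|` A i|)%N%:R `^ alpha) /\
      c' * #|` V n|%:R `^ alpha <= #|` E n|%:R.

Definition reducible V E : Prop :=
  exists (m : nat -> nat) (B : forall n, 'I_(m n) -> {fset T}),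
    [/\ forall n i, (B n i `<=` V n)%fset,
        forall n i j, i != j -> [disjoint B n i & B n j]%fset,
        m @ \oo --> \oo,
        (fun n => (\sum_(i < m n) #|` box (E n) (fun=> B n i)|)%N%:R : R^o)
          ~_\oo (fun n => #|` E n|%:R : R^o) &
        (fun n => (\max_(i < m n) #|` box (E n) (fun=> B n i)|)%N%:R : R^o)
          =o_\oo (fun n => #|` E n|%:R : R^o)].

Definition irreducible V E : Prop := ~ reducible V E.

End Sequences.

Arguments combinatorial_dimension {R T d} V E alpha.

Section Probability.
Context {R : realType} {disp : measure_display} {Omega : measurableType disp}.
Context (P : probability Omega R).

Definition mutually_independent {T : choiceType} (D : set T)
    (X : T -> {RV P >-> R}) : Prop :=
  forall (J : {fset T}) (B : T -> set R),
    [set` J] `<=` D -> (forall v, v \in J -> measurable (B v)) ->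
    P (\bigcap_(v in [set` J]) X v @^-1` B v) =
      (\prod_(v <- J) P (X v @^-1` B v))%E.

Definition iid_standard_normal {T : choiceType} (D : set T)
    (X : T -> {RV P >-> R}) : Prop :=
  mutually_independent D X /\
  forall v, D v -> forall A : set R, measurable A ->
    distribution P (X v) A = normal_prob 0 1 A.

Definition cvg_in_distribution (Y : nat -> {RV P >-> R})
    (mu : probability (measurableTypeR R) R) : Prop :=
  forall r : R, {for r, continuous (fun x : R => mu `]-oo, x]%classic)} ->
    cdf (Y n) r @[n --> \oo] --> mu `]-oo, r]%classic.

Definition homogeneous_sum {T : choiceType} {d : nat} (X : T -> {RV P >-> R})
    (E : {fset d.-tuple T}) : {RV P >-> R} :=
  \sum_(t <- E) \prod_(i < d) (X (tnth t i) : {mfun Omega >-> R}).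

Definition irreducible_CLT {T : choiceType} {d : nat} (X : T -> {RV P >-> R})
    (V : nat -> {fset T}) (E : nat -> {fset d.-tuple T}) : Prop :=
  irreducible R V E /\
  cvg_in_distribution
    (fun n => (Num.sqrt (d`! * #|` E n|)%N%:R)^-1 \o* homogeneous_sum X (E n))
    (normal_prob (0 : R) 1).

End Probability.

(* Main.v *)
From HB Require Import structures.
Require Import Defs.
From mathcomp Require Import all_boot all_order all_fingroup all_algebra.
From mathcomp Require Import finmap zify ring lra.
From mathcomp Require Import all_classical all_reals all_analysis.
From mathcomp Require Import measurable_realfun.

(** Irreducibility.  Suppose that disjoint sets [B_1], ..., [B_m] carried almost
    all of [E], in pieces of size [x_i] that are each [o(|E|)].  Split
    [x_i = x_i^(1/alpha) * x_i^(1 - 1/alpha)].  By the dimension bound the first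
    factor is at most a constant times [|B_i|], so that these factors sum to
    [O(|V|) = O(|E|^(1/alpha))]; as [alpha > 1], the second factor is
    [o(|E|^(1 - 1/alpha))].  Hence the pieces add up to [o(|E|)] only, a
    contradiction ([superlinear_irreducible]).

    The example.  The sets of part (b) are fractional Cartesian products.  A
    function [y] from the cyclic group of order [d] to a set of size [N] gives a
    hyperedge with [d] vertices: the restrictions of [y] to the [d] windows of
    [b] consecutive coordinates, each tagged with its window.  There are about
    [N^b] vertices and [N^d] edges.  Since every coordinate lies in [b] windows,
    the inequality of Finner (a form of Loomis-Whitney, [finner_inequality])
    bounds the number of edges in a box by the product of the [|A_i|^(1/b)].
    So the dimension is [d/b > 1], and irreducibility follows from part (a).

    The central limit theorem.  Let us fix the variables of all windows but
    window [0].  The normalized sum is then a linear combination of independent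
    standard normal variables, hence normal with a random variance [sigma^2],
    and its distribution function is the mean of that of [N(0, sigma^2)]
    ([gaussian_mixture], [head_sum_law]).  It remains to see that [sigma^2] is
    close to [1].  Its mean is [1].  Its second moment is a sum over four
    functions [y0], ..., [y3] on the cyclic group; a term vanishes unless in
    each window the four restrictions agree in pairs, and window [0] forces the
    pairing [y0 ~ y1], [y2 ~ y3].  As [b >= 2], consecutive windows overlap, so
    the pairing passes from one window to the next unless the four functions
    take one common value somewhere.  Without such a coincidence [y0 = y1] and
    [y2 = y3], and these terms contribute at most [1]; a coincidence costs a
    factor [N], so that the other terms contribute [O(1/N)] ([sum_weight]).
    Thus the variance of [sigma^2] is [O(1/N)]. *)


Set Implicit Arguments.
Unset Strict Implicit.
Unset Printing Implicit Defensive.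

Import Order.TTheory GRing.Theory Num.Theory.
Import numFieldNormedType.Exports.

Local Open Scope classical_set_scope.
Local Open Scope ring_scope.

(** * Sets of superlinear combinatorial dimension are irreducible *)

Section superlinear_dimension.
Context {R : realType} {T : choiceType} {d : nat}.
Implicit Types (V : nat -> {fset T}) (E : nat -> {fset d.-tuple T}).
Local Open Scope nat_scope.

Lemma sum_card_disjoint (W : {fset T}) (m : nat) (B : 'I_m -> {fset T}) :
  (forall i, (B i `<=` W)%fset) ->
  (forall i j, i != j -> [disjoint B i & B j]%fset) ->
  \sum_(i < m) #|` B i| <= #|` W|.
Proof.
move=> BW Bdis.
have E i : #|` B i| = \sum_(v <- W) (v \in B i).
  rewrite (eq_bigr (fun v => if v \in B i then 1 else 0)); last first.
    by move=> v _; case: (v \in B i).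
  rewrite -big_mkcond sum1_count -size_filter; apply: perm_size.
  apply: uniq_perm; rewrite ?filter_uniq ?fset_uniq// => v.
  by rewrite mem_filter andb_idr// => /(fsubsetP (BW i)).
rewrite (eq_bigr _ (fun i _ => E i)) exchange_big/= -sum1_size.
apply: leq_sum => v _.
have [i /= vi|none] := pickP [pred i : 'I_m | v \in B i]; last first.
  by rewrite big1// => i _; have := none i; rewrite /= => ->.
rewrite (bigD1 i)//= big1 => [|j ji]; first by rewrite addn0 leq_b1.
apply/eqP; rewrite eqb0; apply/negP => vj.
by have /fdisjointP/(_ v vj) := Bdis j i ji; rewrite vi.
Qed.

Local Open Scope ring_scope.

(** Interpolation: each summand is a product of a power that is controlled by
    [y i] and a power that is controlled by the uniform bound [X]. *)
Lemma sum_powR_le (m : nat) (x y : 'I_m -> R) (c X alpha : R) : 1 < alpha -> 0 <= c ->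
  (forall i, 0 <= y i) -> (forall i, 0 <= x i <= X) ->
  (forall i, x i <= c * y i `^ alpha) ->
  \sum_i x i <= c `^ (alpha^-1) * X `^ (1 - alpha^-1) * \sum_i y i.
Proof.
move=> a1 c0 y0 x0 xy; have a0 : 0 < alpha := lt_trans ltr01 a1.
have ai1 : 0 <= 1 - alpha^-1 by rewrite subr_ge0 invf_le1// ltW.
have ai0 : 0 <= alpha^-1 by rewrite invr_ge0 ltW.
rewrite mulr_sumr; apply: ler_sum => i _.
have /andP[xi0 xiX] := x0 i.
have X0 : 0 <= X := le_trans xi0 xiX.
have -> : x i = x i `^ (alpha^-1) * x i `^ (1 - alpha^-1).
  rewrite -powRD ?subrKC ?powRr1//.
  by rewrite oner_eq0.
rewrite mulrAC; apply: ler_pM; rewrite ?powR_ge0//.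
  apply: (@le_trans _ _ ((c * y i `^ alpha) `^ alpha^-1)).
    by apply: ge0_ler_powR => //; rewrite nnegrE ?mulr_ge0 ?powR_ge0.
  by rewrite powRM ?powR_ge0// -powRrM divff ?gt_eqF// powRr1.
by apply: ge0_ler_powR.
Qed.

Lemma superlinear_irreducible V E (alpha : R) :
  #|` E n|%fset @[n --> \oo] --> \oo ->
  combinatorial_dimension V E alpha -> 1 < alpha ->
  irreducible R V E.
Proof.
move=> Ey [_ [c' [c [/andP[c'0 c'c] dimE]]]] a1 [m [B [BV Bdis _ Sigma Max]]].
have a0 : 0 < alpha := lt_trans ltr01 a1.
have c0 : 0 < c := lt_le_trans c'0 c'c.
have ai1 : 0 < 1 - alpha^-1 by rewrite subr_gt0 invf_lt1.
have ai0 : 0 <= alpha^-1 by rewrite invr_ge0 ltW.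
pose k : R := (c / c') `^ alpha^-1.
have k0 : 0 < k by rewrite powR_gt0// divr_gt0.
(* for this [eps] the pieces add up to at most [|E| / 4], while they must reach
   [|E| / 2] *)
pose eps : R := (4 * k)^-1 `^ (1 - alpha^-1)^-1.
have eps0 : 0 < eps by rewrite powR_gt0// invr_gt0 mulr_gt0.
move/eqaddoP : Sigma => /(_ (1/2) ltac:(lra)) Sigma.
move/eqoP : Max => /(_ eps eps0) Max.
have {}Sigma : \forall n \near \oo,
    `|(\sum_(i < m n) #|` box (E n) (fun=> B n i)|)%N%:R - (#|` E n|%:R : R)|
      <= 1 / 2 * (#|` E n|%:R : R).
  by apply: filterS Sigma => n; rewrite /= [X in _ * X]ger0_norm.
have {}Max : \forall n \near \oo,
    (\max_(i < m n) #|` box (E n) (fun=> B n i)|)%N%:R <= eps * (#|` E n|%:R : R).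
  by apply: filterS Max => n; rewrite /= !ger0_norm.
move/cvgnyPge : Ey => /(_ 1%N) Ey.
near \oo => n.
have [boxle sizele] : (forall A : 'I_d -> {fset T}, (forall i, A i `<=` V n)%fset ->
         #|` box (E n) A|%:R
           <= c * (\max_(i < d) #|` A i|)%N%:R `^ alpha) /\
      c' * #|` V n|%:R `^ alpha <= #|` E n|%:R by near: n.
pose x i : R := #|` box (E n) (fun=> B n i)|%:R.
pose y i : R := #|` B n i|%:R.
pose e : R := #|` E n|%:R.
have e1 : 1 <= e by rewrite ler1n; near: n.
have S1 : `|(\sum_i x i) - e| <= 1 / 2 * e.
  by rewrite -natr_sum /e; near: n; exact: Sigma.
have M1 : (\max_(i < m n) #|` box (E n) (fun=> B n i)|)%N%:R <= eps * e.
  by rewrite /e; near: n; exact: Max.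
have := @sum_powR_le (m n) x y c (eps * e) alpha a1 (ltW c0).
have y0 i : 0 <= y i by rewrite ler0n.
have xX i : 0 <= x i <= eps * e.
  rewrite ler0n/=; apply: le_trans M1; rewrite ler_nat.
  exact: (leq_bigmax (F := fun i => #|` box (E n) (fun=> B n i)|%fset)).
have xy i : x i <= c * y i `^ alpha.
  apply: (le_trans (boxle _ _)); first by move=> _; exact: BV.
  rewrite ler_pM2l//; apply: ge0_ler_powR; rewrite ?nnegrE ?ler0n// ?(ltW a0)//.
  by rewrite ler_nat; apply/bigmax_leqP.
move=> /(_ y0 xX xy) H.
have Sy : \sum_i y i <= (e / c') `^ alpha^-1.
  apply: (@le_trans _ _ #|` V n|%:R).
    by rewrite -natr_sum ler_nat; apply: sum_card_disjoint; [exact: BV|exact: Bdis].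
  have -> : #|` V n|%:R = (#|` V n|%:R `^ alpha) `^ alpha^-1 :> R.
    by rewrite -powRrM divff ?gt_eqF// powRr1.
  apply: ge0_ler_powR => //; rewrite ?nnegrE ?powR_ge0//.
    by rewrite mulr_ge0 ?invr_ge0 ?(ltW c'0)// (le_trans ler01).
  by rewrite ler_pdivlMr// mulrC.
have e0 : 0 < e := lt_le_trans ltr01 e1.
have : \sum_i x i <= 1 / 4 * e.
  apply: (le_trans H).
  apply: (@le_trans _ _ (c `^ alpha^-1 * (eps * e) `^ (1 - alpha^-1) * (e / c') `^ alpha^-1)).
    by rewrite ler_wpM2l// mulr_ge0 ?powR_ge0.
  rewrite powRM ?(ltW eps0) ?(ltW e0)// powRM ?(ltW e0) ?invr_ge0 ?(ltW c'0)//.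
  have -> : eps `^ (1 - alpha^-1) = (4 * k)^-1.
    by rewrite /eps -powRrM mulVf ?gt_eqF// powRr1// invr_ge0 mulr_ge0// ltW.
  have -> : c `^ alpha^-1 * ((4 * k)^-1 * e `^ (1 - alpha^-1)) *
      (e `^ alpha^-1 * (c'^-1) `^ alpha^-1) =
      (c `^ alpha^-1 * (c'^-1) `^ alpha^-1) * (4 * k)^-1 * (e `^ (1 - alpha^-1) * e `^ alpha^-1).
    by ring.
  rewrite -powRM ?(ltW c0) ?invr_ge0 ?(ltW c'0)// -/k -powRD; last first.
    by apply/implyP => _; rewrite gt_eqF.
  rewrite subrK powRr1 ?(ltW e0)//.
  by rewrite le_eqVlt; apply/orP; left; apply/eqP; field; rewrite gt_eqF.
move: S1; rewrite ler_norml; lra.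
Unshelve. all: by end_near. Qed.

End superlinear_dimension.

(** * Scaled Gaussian laws and Gaussian moments *)

Section gauss.
Context {R : realType}.
Implicit Types (s m a b r x : R).
Local Notation mu := (@lebesgue_measure R).

(** The distribution function of [s] times a standard normal variable.  Unlike
    [normal_prob 0 s], it is correct at [s = 0], where the law is a point mass;
    the random standard deviations below may vanish. *)
Definition gaussian_cdf s b : \bar R :=
  normal_prob (0 : R) 1 [set x | s * x <= b].

Lemma measurable_halfline s m b : measurable [set x : R | s * x + m <= b].
Proof.
rewrite (_ : [set x | _] = (fun x => s * x + m) @^-1` `]-oo, b]); last first.
  by apply/seteqP; split=> x /=; rewrite in_itv.
rewrite -[X in measurable X]setTI.
by apply: (measurable_funD (measurable_funM _ _)).
Qed.

Lemma measurable_scaled_halfline s b : measurable [set x : R | s * x <= b].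
Proof.
have := measurable_halfline s 0 b; congr measurable.
by apply/seteqP; split => x /=; rewrite addr0.
Qed.

Lemma gaussian_cdf_fin_num s b : gaussian_cdf s b \is a fin_num.
Proof. by apply: fin_num_measure; exact: measurable_scaled_halfline. Qed.

Lemma fine_gaussian_cdf s b : 0 <= fine (gaussian_cdf s b) <= 1.
Proof.
rewrite fine_ge0//= -lee_fin fineK ?gaussian_cdf_fin_num//.
by apply: probability_le1; exact: measurable_scaled_halfline.
Qed.

Lemma normal_peakE s : 0 < s -> normal_peak s = s^-1 * normal_peak 1.
Proof.
move=> s0; rewrite /normal_peak expr1n mul1r -mulrnAr sqrtrM ?sqr_ge0//.
by rewrite sqrtr_sqr gtr0_norm// invfM.
Qed.

Lemma normal_prob_affine m s b : 0 < s ->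
  normal_prob (0 : R) 1 [set x | s * x + m <= b] = normal_prob m s `]-oo, b].
Proof.
move=> s0; pose F x := s * x + m.
have dF x : is_derive x 1 F s.
  by rewrite /F; apply: is_derive_eq; rewrite addr0 /= /GRing.scale /= mulr1.
have cF : continuous F.
  by move=> x; apply/differentiable_continuous/derivable1_diffP; apply: ex_derive.
have F'E : F^`()%classic = cst s.
  by apply/funext => x; rewrite derive1E; apply: derive_val.
have Fb : F ((b - m) / s) = b by rewrite /F mulrC divfK ?gt_eqF// subrK.
have -> : [set x | s * x + m <= b] = `]-oo, (b - m) / s]%classic.
  by apply/seteqP; split=> x /=; rewrite in_itv/= ler_pdivlMr// lerBrDr mulrC.
rewrite /normal_prob -[in RHS]Fb.
rewrite (@increasing_ge0_integration_by_substitutionNy _ F (normal_pdf m s)).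
- apply: eq_integral => x _; rewrite F'E /= !normal_pdfE ?gt_eqF// /normal_fun.
  congr EFin; rewrite /F !fctE /= addrK subr0 (normal_peakE s0).
  have -> : - (s * x) ^+ 2 / (s ^+ 2 *+ 2) = - x ^+ 2 / (1 ^+ 2 *+ 2).
    by field; lra.
  by field; lra.
- by move=> x y _ _ xy; rewrite /F ltrD2r ltr_pM2l.
- by move=> x _; rewrite F'E; exact: cst_continuous.
- by rewrite F'E; exact: is_cvg_cst.
- by rewrite F'E; exact: cvg_cst.
- split=> [x _|]; first exact: ex_derive.
  by apply: cvg_at_left_filter; exact: cF.
- apply/cvgrNyPle => A; apply: filterS (nbhs_ninfty_le (num_real ((A - m) / s))).
  by move=> x; rewrite ler_pdivlMr// lerBrDr mulrC.
- by apply/continuous_subspaceT/continuous_normal_pdf; rewrite gt_eqF.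
- by move=> x _; exact: normal_pdf_ge0.
Qed.

(** Completing the square.  Bayes rule in the Gaussian model: a normal [y]
    observed as [a * y] plus noise of standard deviation [s] gives a normal
    observation, and a normal posterior law of [y]. *)
Lemma normal_pdf_mul s a y z : 0 < s ->
  let c := Num.sqrt (s ^+ 2 + a ^+ 2) in
  normal_pdf (a * y) s z * normal_pdf 0 1 y =
  normal_pdf 0 c z * normal_pdf (a * z / c ^+ 2) (s / c) y.
Proof.
move=> s0 c.
have c2 : c ^+ 2 = s ^+ 2 + a ^+ 2.
  by rewrite sqr_sqrtr// addr_ge0 ?sqr_ge0.
have c20 : 0 < s ^+ 2 + a ^+ 2 by rewrite ltr_pwDl ?sqr_ge0 ?exprn_gt0.
have c0 : 0 < c by rewrite sqrtr_gt0.
rewrite !normal_pdfE ?gt_eqF ?divr_gt0// /normal_fun.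
rewrite (normal_peakE s0) (normal_peakE c0) (normal_peakE (divr_gt0 s0 c0)).
rewrite mulrACA [in RHS]mulrACA -!expRD; congr (_ * expR _).
  by field; rewrite !gt_eqF.
rewrite expr_div_n c2.
by field; rewrite !gt_eqF.
Qed.

(** The Radon-Nikodym derivative of the normal law is its density. *)
Lemma ge0_integral_normal_prob m s (f : R -> \bar R) :
  measurable_fun setT f -> (forall x, (0 <= f x)%E) ->
  (\int[normal_prob m s]_x f x = \int[mu]_x (f x * (normal_pdf m s x)%:E))%E.
Proof.
move=> mf f0; have dom := normal_prob_dominates m s.
have iD := Radon_Nikodym_SigmaFinite.f_integrable dom.
rewrite -(Radon_Nikodym_SigmaFinite.change_of_variables dom)//.
have mpdf : measurable_fun setT (EFin \o normal_pdf m s).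
  by apply/measurable_EFinP; exact: measurable_normal_pdf.
apply: ae_eq_integral => //.
- by apply: emeasurable_funM => //; case/integrableP: iD.
- exact: emeasurable_funM.
- apply: ae_eqe_mul2l => /=; apply: integral_ae_eq => //=.
  by move=> E _ mE; rewrite -Radon_Nikodym_SigmaFinite.f_integral.
Qed.

Lemma gaussian_cdf_abs s b : gaussian_cdf `|s| b = gaussian_cdf s b.
Proof.
rewrite /gaussian_cdf; have [|s0] := ger0P s => //.
have t0 : 0 < - s by rewrite oppr_gt0.
have -> : [set x | - s * x <= b] = `]-oo, - (b / s)]%classic.
  by apply/seteqP; split=> x /=; rewrite in_itv/= -mulrN -invrN ler_pdivlMr// mulrC.
have -> : [set x | s * x <= b] = `[b / s, +oo[%classic.
  by apply/seteqP; split=> x /=; rewrite in_itv/= andbT ler_ndivrMr// mulrC.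
rewrite /normal_prob ge0_integration_by_substitutionNy.
- apply: eq_integral => x _; rewrite /= !normal_pdfE ?oner_neq0// /normal_fun.
  by rewrite !subr0 sqrrN.
- by apply/continuous_subspaceT/continuous_normal_pdf; rewrite oner_neq0.
- by move=> x _; exact: normal_pdf_ge0.
Qed.

Lemma measurable_gaussian_cdf :
  measurable_fun setT (fun p : R * R => gaussian_cdf p.1 p.2).
Proof.
pose A := [set q : (R * R) * R | q.1.1 * q.2 - q.1.2 <= 0].
have mA : measurable A.
  rewrite (_ : A = (fun q : (R * R) * R => q.1.1 * q.2 - q.1.2) @^-1` `]-oo, 0]);
    last by apply/seteqP; split=> q /=; rewrite in_itv.
  rewrite -[X in measurable X]setTI.
  have m11 : measurable_fun setT (fun q : (R * R) * R => q.1.1).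
    exact: measurableT_comp.
  have m12 : measurable_fun setT (fun q : (R * R) * R => q.1.2).
    exact: measurableT_comp.
  apply: (measurable_funB (measurable_funM m11 _) m12) => //.
rewrite (_ : (fun _ => _) = normal_prob 0 1 \o xsection A).
  exact: measurable_fun_xsection.
apply/funext => p /=; congr normal_prob; apply/seteqP.
by split => x; rewrite /xsection/= inE /A/= subr_le0.
Qed.

Lemma gaussian_cdf0 b : gaussian_cdf 0 b = (0 <= b)%R%:R%:E.
Proof.
rewrite /gaussian_cdf; case: (leP 0 b) => b0.
  rewrite (_ : [set _ | _] = setT) ?probability_setT//.
  by apply/seteqP; split=> x //= _; rewrite mul0r.
rewrite (_ : [set _ | _] = set0) ?measure0//.
by apply/seteqP; split=> x //=; rewrite mul0r leNgt b0.
Qed.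

(** Two independent normal variables add their variances: after exchanging the
    integrals, [normal_pdf_mul] leaves a normal density in [y], whose mass is
    [1].  The degenerate cases are treated apart. *)
Lemma gaussian_cdf_mix s a b :
  (\int[normal_prob 0 1]_y gaussian_cdf s (b - a * y) =
   gaussian_cdf (Num.sqrt (s ^+ 2 + a ^+ 2)) b)%E.
Proof.
wlog : s / 0 <= s => [hw|].
  by rewrite -real_normK ?num_real// -hw//; apply: eq_integral => y _; rewrite gaussian_cdf_abs.
rewrite le_eqVlt => /predU1P[<-|s0].
  rewrite expr0n add0r sqrtr_sqr gaussian_cdf_abs.
  rewrite /gaussian_cdf.
  rewrite -[in RHS](setIT [set _ | _]) -integral_indic//; last first.
    exact: measurable_scaled_halfline.
  apply: eq_integral => y _; rewrite [LHS]gaussian_cdf0 indicE subr_ge0.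
  by congr (nat_of_bool _)%:R%:E; apply/idP/idP => [h|/set_mem//]; exact: mem_set.
pose c := Num.sqrt (s ^+ 2 + a ^+ 2).
have c0 : 0 < c by rewrite sqrtr_gt0 ltr_pwDl ?sqr_ge0 ?exprn_gt0.
rewrite ge0_integral_normal_prob//; last first.
  apply: (@measurableT_comp _ _ _ _ _ _ (fun p : R * R => gaussian_cdf p.1 p.2)
    _ (fun y => (s, b - a * y))); first exact: measurable_gaussian_cdf.
  apply: measurable_fun_pair=> //; exact: measurable_funB.
pose f (y z : R) : \bar R := (normal_pdf (a * y) s z * normal_pdf 0 1 y)%:E.
transitivity (\int[mu]_y \int[mu]_(z in `]-oo, b]) f y z)%E.
  apply: eq_integral => y _.
  have -> : gaussian_cdf s (b - a * y) = normal_prob (a * y) s `]-oo, b].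
    rewrite -normal_prob_affine// /gaussian_cdf.
    by congr normal_prob; apply/seteqP; split => x /=; rewrite lerBrDr.
  rewrite /normal_prob muleC -ge0_integralZl//.
  - by apply: eq_integral => z _; rewrite /f EFinM muleC.
  - apply/measurable_EFinP/measurable_funTS; exact: measurable_normal_pdf.
  - by move=> z _; rewrite lee_fin normal_pdf_ge0.
  - by rewrite lee_fin normal_pdf_ge0.
transitivity (\int[mu]_(z in `]-oo, b]) \int[mu]_y f y z)%E.
  under eq_integral do rewrite integral_mkcond.
  rewrite [RHS]integral_mkcond.
  pose g (p : R * R) := (f p.1 p.2 * (\1_`]-oo, b]%classic p.2)%:E)%E.
  transitivity (\int[mu]_y \int[mu]_z g (y, z))%E.
    apply: eq_integral => y _; apply: eq_integral => z _.
    by rewrite /g patchE indicE; case: ifP => _; rewrite ?mule1 ?mule0.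
  rewrite fubini_tonelli.
  - apply: eq_integral => z _; rewrite patchE /g /=; case: ifP => zb.
      by apply: eq_integral => y _; rewrite indicE zb mule1.
    by under eq_integral do rewrite indicE zb mule0; rewrite integral0.
  - apply: emeasurable_funM; apply/measurable_EFinP; last first.
      by apply: measurableT_comp => //; exact: measurable_indic.
    apply: measurable_funM; last first.
      by apply: measurableT_comp => //; exact: measurable_normal_pdf.
    under eq_fun do rewrite normal_pdfE ?gt_eqF//.
    apply: measurable_funM => //; apply: measurableT_comp => //.
    apply: measurable_funM => //; apply: measurableT_comp => //.
    apply: measurable_funX; apply: measurable_funB => //.
    exact: measurable_funM.
  - by move=> [y z]; rewrite /g/= -EFinM lee_fin !mulr_ge0 ?normal_pdf_ge0.
rewrite /gaussian_cdf -/c.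
have -> : [set x | c * x <= b] = [set x | c * x + 0 <= b].
  by apply/seteqP; split => x /=; rewrite addr0.
rewrite normal_prob_affine// /normal_prob; apply: eq_integral => z _.
rewrite /f; under eq_integral do rewrite normal_pdf_mul// EFinM.
rewrite ge0_integralZl//.
- by rewrite integral_normal_pdf// mule1.
- by apply/measurable_EFinP; exact: measurable_normal_pdf.
- by move=> y _; rewrite lee_fin normal_pdf_ge0.
- by rewrite lee_fin normal_pdf_ge0.
Qed.
End gauss.

Section moments.
Context {R : realType}.
Implicit Types (s m a b r x y t : R) (k : nat).
Local Notation mu := (@lebesgue_measure R).
Local Notation gamma := (normal_prob (0 : R) 1).
Local Notation phi := (normal_pdf (0 : R) 1).

Lemma phiE x : phi x = normal_peak 1 * expR (- (x ^+ 2 / 2)).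
Proof.
by rewrite normal_pdfE ?oner_neq0// /normal_fun subr0 expr1n mulNr.
Qed.

Lemma measurable_phi : measurable_fun setT phi.
Proof. exact: measurable_normal_pdf. Qed.

Lemma measurable_pow k : measurable_fun setT (fun x : R => x ^+ k).
Proof. exact: measurable_funX. Qed.

(** Up to a constant, [x ^+ k] is at most [expR (x ^+ 2 / 4)], which turns the
    standard normal density into a multiple of that of variance [2]. *)
Lemma integrable_normal_pow k : gamma.-integrable setT (fun x => (x ^+ k)%:E).
Proof.
apply/integrableP; split; first by apply/measurable_EFinP; exact: measurable_pow.
rewrite ge0_integral_normal_prob//; last first.
  by apply: measurableT_comp => //; apply/measurable_EFinP; exact: measurable_pow.
(* [c] is the standard deviation of the dominating normal law *)
pose c : R := Num.sqrt 2.
have c2 : c ^+ 2 = 2 by rewrite sqr_sqrtr.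
have c0 : 0 < c by rewrite sqrtr_gt0.
pose K := (4 ^+ k.+1 * k.+1`!%:R + 1) * (normal_peak 1 / normal_peak c) : R.
have K0 : 0 <= K.
  by rewrite mulr_ge0 ?addr_ge0 ?mulr_ge0 ?invr_ge0 ?normal_peak_ge0 ?exprn_ge0.
apply: (@le_lt_trans _ _ (\int[mu]_x (K%:E * (normal_pdf 0 c x)%:E))%E).
  apply: ge0_le_integral => //.
  - by move=> x _; rewrite mule_ge0// lee_fin normal_pdf_ge0.
  - apply: emeasurable_funM; last by apply/measurable_EFinP; exact: measurable_phi.
    by apply: measurableT_comp => //; apply/measurable_EFinP; exact: measurable_pow.
  - apply: emeasurable_funM => //.
    by apply/measurable_EFinP; exact: measurable_normal_pdf.
  move=> x _; rewrite -!EFinM lee_fin phiE (normal_pdfE _ (lt0r_neq0 c0)).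
  rewrite /normal_fun subr0 c2.
  have -> : K * (normal_peak c * expR (- x ^+ 2 / (2 *+ 2))) = normal_peak 1 *
      ((4 ^+ k.+1 * k.+1`!%:R + 1) * expR (- x ^+ 2 / (2 *+ 2))).
    by rewrite /K; field; rewrite gt_eqF// normal_peak_gt0// gt_eqF.
  rewrite mulrCA ler_wpM2l ?normal_peak_ge0//.
  have -> : expR (- (x ^+ 2 / 2)) = expR (- (x ^+ 2) / (2 *+ 2)) * expR (- (x ^+ 2) / (2 *+ 2)).
    by rewrite -expRD; congr expR; field.
  rewrite mulrA ler_wpM2r ?expR_ge0//.
  rewrite mulNr expRN ler_pdivrMr ?expR_gt0// normrX.
  have x40 : 0 <= x ^+ 2 / (2 *+ 2) by rewrite mulr_ge0 ?sqr_ge0// invr_ge0.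
  have h := expR_ge1Dxn k x40.
  have h1 : 1 <= expR (x ^+ 2 / (2 *+ 2)) by rewrite -[leLHS]expR0 ler_expR.
  have [x1|x1] := leP `|x| 1.
    apply: (@le_trans _ _ 1); first by rewrite exprn_ile1.
    rewrite -[leLHS]mul1r ler_pM// lerDr mulr_ge0// exprn_ge0//.
  rewrite mulrDl mul1r -[leLHS]addr0 lerD//.
  have h2 : (x ^+ 2 / (2 *+ 2)) ^+ k.+1 / k.+1`!%:R <= expR (x ^+ 2 / (2 *+ 2)).
    by apply: le_trans h; rewrite lerDr.
  rewrite ler_pdivrMr ?ltr0n ?fact_gt0// expr_div_n ler_pdivrMr ?exprn_gt0// in h2.
  apply: (@le_trans _ _ ((x ^+ 2) ^+ k.+1)).
    rewrite -real_normK ?num_real// -exprM ler_weXn2l ?ltW//.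
    by lia.
  by apply: (le_trans h2); rewrite le_eqVlt; apply/orP; left; apply/eqP;
    rewrite (_ : 2 *+ 2 = 4); ring.
rewrite ge0_integralZl//.
- by rewrite integral_normal_pdf mule1 ltry.
- by apply/measurable_EFinP; exact: measurable_normal_pdf.
- by move=> x _; rewrite lee_fin normal_pdf_ge0.
Qed.

Definition gaussian_moment k : R := fine (\int[gamma]_x (x ^+ k)%:E)%E.

Lemma gaussian_momentE k :
  (\int[gamma]_x (x ^+ k)%:E)%E = (gaussian_moment k)%:E.
Proof.
rewrite fineK//; apply: integrable_fin_num => //; exact: integrable_normal_pow.
Qed.

Lemma gaussian_moment0 : gaussian_moment 0 = 1.
Proof.
rewrite /gaussian_moment; under eq_integral do rewrite expr0.
by rewrite integral_cst//= mul1e probability_setT.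
Qed.

Lemma gaussian_moment4_ge0 : 0 <= gaussian_moment 4.
Proof.
apply: fine_ge0; apply: integral_ge0 => x _.
by rewrite lee_fin exprn_even_ge0.
Qed.

Lemma ge0_integral_oppr (G : R -> R) : continuous G -> (forall x, 0 <= G x) ->
  (\int[mu]_x (G x)%:E = \int[mu]_x (G (- x))%:E)%E.
Proof.
have split0 (H : R -> R) : continuous H -> (forall x, 0 <= H x) ->
    (\int[mu]_x (H x)%:E = \int[mu]_(x in `[0%R, +oo[) (H (- x))%:E +
                           \int[mu]_(x in `[0%R, +oo[) (H x)%:E)%E.
  move=> cH H0; have mH := continuous_measurable_fun cH.
  rewrite -(setUv (`]-oo, 0]%classic : set R)) ge0_integral_setU//=; last 4 first.
  - exact: measurableC.
  - by apply/measurable_EFinP; exact: measurable_funTS.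
  - by move=> x _; rewrite lee_fin.
  - exact/disj_setPCl.
  rewrite setCitvl; congr +%E; last first.
    by rewrite integral_itv_obnd_cbnd//; apply/measurable_EFinP/measurable_funTS.
  rewrite -{1}oppr0 ge0_integration_by_substitutionNy//.
  exact: continuous_subspaceT.
move=> cG G0; rewrite split0// split0//; last first.
  by move=> x; apply: continuous_comp; [exact: oppr_continuous|exact: cG].
by rewrite addeC; congr +%E; apply: eq_integral => x _; rewrite opprK.
Qed.

Lemma gaussian_moment_odd k : odd k -> gaussian_moment k = 0.
Proof.
move=> ok; rewrite /gaussian_moment integralE.
have cp : continuous (fun x : R => Num.max (x ^+ k) 0 * phi x).
  move=> x; apply: cvgM; last first.
    by apply: continuous_normal_pdf; rewrite oner_neq0.
  apply: (@continuous_max _ _ (fun t : R => t ^+ k) (cst 0) x); last exact: cst_continuous.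
  exact: exprn_continuous.
have E1 : (\int[gamma]_x ((fun x => (x ^+ k)%:E)^\+ x) =
    \int[mu]_x (Num.max (x ^+ k) 0 * phi x)%:E)%E.
  rewrite ge0_integral_normal_prob//.
    by apply: eq_integral => x _; rewrite funeposE EFinM EFin_max.
  by apply: measurable_funepos; apply/measurable_EFinP; exact: measurable_pow.
have E2 : (\int[gamma]_x ((fun x => (x ^+ k)%:E)^\- x) =
    \int[mu]_x (Num.max ((- x) ^+ k) 0 * phi (- x))%:E)%E.
  rewrite ge0_integral_normal_prob//.
    apply: eq_integral => x _; rewrite funenegE EFinM EFin_max.
    rewrite exprNn -signr_odd ok expr1 mulN1r EFinN; congr (_ * _%:E)%E.
    by rewrite !phiE sqrrN.
  by apply: measurable_funeneg; apply/measurable_EFinP; exact: measurable_pow.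
rewrite E1 E2 -(@ge0_integral_oppr (fun x => Num.max (x ^+ k) 0 * phi x))//.
  by rewrite subee// -E1; apply: integrable_pos_fin_num => //;
    exact: integrable_normal_pow.
by move=> x; rewrite mulr_ge0 ?normal_pdf_ge0// le_max lexx orbT.
Qed.

Lemma integral_halfline_x_phi x : 0 <= x ->
  (\int[mu]_(t in `[x, +oo[) (t * phi t)%:E = (phi x)%:E)%E.
Proof.
move=> x0; have dphi t : is_derive t 1 (fun t => - phi t) (t * phi t).
  have -> : (fun t => - phi t) = (fun t => - (normal_peak 1 * expR (- (t ^+ 2 / 2)))).
    by apply/funext => u; rewrite phiE.
  by apply: is_derive_eq; rewrite phiE /GRing.scale/=; field.
rewrite (@ge0_continuous_FTC2y _ (fun t => t * phi t) (fun t => - phi t) x 0).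
- by rewrite EFinN oppeK add0e.
- by move=> t xt; rewrite mulr_ge0 ?normal_pdf_ge0// (le_trans x0).
- apply: continuous_subspaceT => t; apply: cvgM; first exact: cvg_id.
  by apply: continuous_normal_pdf; rewrite oner_neq0.
- have -> : (fun t => - phi t) = (fun t => - normal_peak 1 * expR (- (t ^+ 2 / 2))).
    by apply/funext => t; rewrite phiE mulNr.
  rewrite -(mulr0 (- normal_peak 1)).
  apply: cvgM; first exact: cvg_cst.
  apply: (cvg_comp (fun t => t ^+ 2 / 2) (fun t => expR (- t))).
    by apply/gt0_cvgMly; [rewrite invr_gt0|exact: cvgr_expr2].
  exact: cvgr_expR.
- by move=> t _; apply: ex_derive.
- apply: cvg_at_right_filter; apply: continuousN.
  by apply: continuous_normal_pdf; rewrite oner_neq0.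
- by move=> t _; rewrite derive1E; apply: derive_val.
Qed.

(** For [x >= 0] the density [phi x] is the integral of [t * phi t] over [t >= x].
    Exchanging the order of integration in the total mass of the half-line
    turns [phi] into [t * (t * phi t)]. *)
Lemma gaussian_moment2 : gaussian_moment 2 = 1.
Proof.
have even (h : R -> R) : (forall x, 0 <= h x) -> continuous h -> h =1 h \o -%R ->
    (\int[mu]_x (h x)%:E = 2%:E * \int[mu]_(x in `[0%R, +oo[) (h x)%:E)%E.
  by move=> h0 ch hs; rewrite ge0_symfun_integralT// set_itvcy.
suff E : (\int[mu]_(x in `[0%R, +oo[) (x ^+ 2 * phi x)%:E =
          \int[mu]_(x in `[0%R, +oo[) (phi x)%:E)%E.
  rewrite /gaussian_moment ge0_integral_normal_prob//.
  - under eq_integral do rewrite -EFinM.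
    rewrite (even (fun x => x ^+ 2 * phi x)).
    + by rewrite E -even ?integral_normal_pdf//; first
       [exact: normal_pdf_ge0 | by apply: continuous_normal_pdf; rewrite oner_neq0
       | by move=> x /=; rewrite !phiE sqrrN].
    + by move=> x; rewrite mulr_ge0 ?normal_pdf_ge0 ?sqr_ge0.
    + move=> t; apply: cvgM; first exact: exprn_continuous.
      by apply: continuous_normal_pdf; rewrite oner_neq0.
    + by move=> x /=; rewrite !phiE sqrrN.
  - by apply/measurable_EFinP; exact: measurable_pow.
  - by move=> x; rewrite lee_fin sqr_ge0.
pose h (x t : R) := ((t * phi t)%:E * (((0 <= x) && (x <= t))%R%:R)%:E)%E : \bar R.
transitivity (\int[mu]_t \int[mu]_x h x t)%E.
  rewrite integral_mkcond; apply: eq_integral => t _; rewrite patchE.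
  case: ifPn.
    rewrite inE/= in_itv/= andbT => t0.
    have -> : (t ^+ 2 * phi t)%:E = ((t * phi t)%:E * mu `[0%R, t])%E.
      rewrite lebesgue_measure_itv/= lte_fin; case: ltP => [_|t0'].
        by rewrite sube0 -EFinM; congr EFin; ring.
      by rewrite (@le_anti _ R t 0) ?t0 ?t0'// expr0n !mul0r mule0.
    rewrite /h -integral_cst//.
    rewrite integral_mkcond; apply: eq_integral => x _.
    rewrite patchE mem_setE in_itv/=.
    by case: ifP => _; rewrite ?mule1 ?mule0.
  rewrite notin_setE/= in_itv/= andbT => /negP; rewrite -ltNge => t0.
  rewrite /h; symmetry; apply: integral0_eq => x _.
  case: andP => [[x0 xt]|_]; last by rewrite mule0.
  by have := lt_le_trans t0 (le_trans x0 xt); rewrite ltxx.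
transitivity (\int[mu]_x \int[mu]_t h x t)%E; last first.
  rewrite [RHS]integral_mkcond; apply: eq_integral => x _; rewrite patchE.
  rewrite mem_setE in_itv/= andbT /h; case: ifPn => x0.
    rewrite -(integral_halfline_x_phi x0) [RHS]integral_mkcond.
    apply: eq_integral => t _; rewrite patchE mem_setE in_itv/= andbT/=.
    by case: ifP => _; rewrite ?mule1 ?mule0.
  by apply: integral0_eq => t _; rewrite mule0.
pose A := [set p : R * R | 0 <= p.2] `&` [set p : R * R | p.2 - p.1 <= 0].
have mA : measurable A.
  apply: measurableI.
    rewrite (_ : mkset _ = snd @^-1` `[0, +oo[); last first.
      by apply/seteqP; split=> p /=; rewrite in_itv/= andbT.
    by rewrite -[X in measurable X]setTI; apply: measurable_snd.
  rewrite (_ : mkset _ = (fun p : R * R => p.2 - p.1) @^-1` `]-oo, 0]); last first.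
    by apply/seteqP; split=> p /=; rewrite in_itv.
  by rewrite -[X in measurable X]setTI; apply: measurable_funB.
have hE p : h p.2 p.1 = ((p.1 * phi p.1)%:E * (\1_A p)%:E)%E.
  congr (_ * (nat_of_bool _)%:R%:E)%E; rewrite -(subr_le0 p.1 p.2) /A.
  by apply/idP/idP => [/andP[? ?]|/set_mem[? ?]]; [exact: mem_set|exact/andP].
pose hh (p : R * R) := h p.2 p.1.
transitivity (\int[mu]_t \int[mu]_x hh (t, x))%E; first by [].
rewrite fubini_tonelli//.
  rewrite /hh; under eq_fun do rewrite hE.
  apply: emeasurable_funM; apply/measurable_EFinP; last exact: measurable_indic.
  apply: measurable_funM => //.
  by apply: measurableT_comp => //; exact: measurable_phi.
move=> [t x]; rewrite /hh/h/= -EFinM lee_fin.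
case: andP => [[x0 xt]|_]; last by rewrite mulr0.
by rewrite mulr1 mulr_ge0 ?normal_pdf_ge0// (le_trans x0).
Qed.

Lemma fine_normal_prob_itv a b : a <= b ->
  0 <= fine (gamma `]-oo, b]) - fine (gamma `]-oo, a]) <= normal_peak 1 * (b - a).
Proof.
move=> ab.
have E : (gamma `]-oo, b] = gamma `]-oo, a] + gamma `]a, b])%E.
  rewrite -measureU//; last first.
    by apply/seteqP; split=> x //=; rewrite !in_itv/= => -[] xa /andP[]; rewrite ltNge xa.
  congr (gamma _); apply/seteqP; split=> x /=; rewrite !in_itv/=.
    by move=> ->; rewrite andbT; case: (leP x a) => _; [left|right].
  by case => [/le_trans ->//|/andP[]].
have fin A : measurable A -> gamma A \is a fin_num by move=> mA; exact: fin_num_measure.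
rewrite E fineD ?fin// addrAC subrr add0r fine_ge0//=.
rewrite -lee_fin fineK ?fin//.
apply: (@le_trans _ _ (\int[mu]_(x in `]a, b]) (normal_peak 1)%:E))%E.
  apply: ge0_le_integral => //.
  - by move=> x _; rewrite lee_fin normal_pdf_ge0.
  - by apply/measurable_EFinP/measurable_funTS; exact: measurable_phi.
  - by move=> x _; rewrite lee_fin normal_pdf_ub ?oner_neq0.
rewrite integral_cst//= lebesgue_measure_itv/= lte_fin.
case: ltP => [_|ba]; first by rewrite -EFinD -EFinM.
by rewrite mule0 lee_fin mulr_ge0 ?normal_peak_ge0// subr_ge0.
Qed.

(** The bound is stated in terms of [s ^+ 2], the quantity whose moments can be
    computed. *)
Lemma gaussian_cdf_lipschitz r : exists2 C : R, 0 <= C & forall s, 0 <= s ->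
  `| fine (gaussian_cdf s r) - fine (gamma `]-oo, r]) | <= C * `|s ^+ 2 - 1|.
Proof.
have fin A : measurable A -> gamma A \is a fin_num by move=> mA; exact: fin_num_measure.
(* the first term serves for [s >= 1 / 2], where the density is bounded; the
   second one for [s < 1 / 2], where [1 <= 2 * `|s ^+ 2 - 1|] *)
exists (2 * normal_peak 1 * `|r| + 2).
  by rewrite addr_ge0 ?mulr_ge0 ?normal_peak_ge0.
move=> s s0; have [s12|s12] := leP (1 / 2) s.
  have sp : 0 < s by lra.
  have -> : gaussian_cdf s r = gamma `]-oo, r / s].
    rewrite /gaussian_cdf; congr (gamma _); apply/seteqP.
    by split => x /=; rewrite in_itv/= ler_pdivlMr// mulrC.
  apply: (@le_trans _ _ (normal_peak 1 * `|r / s - r|)).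
    have [h|h] := leP r (r / s).
      have /andP[h1 h2] := fine_normal_prob_itv h.
      by rewrite ger0_norm// [in leRHS]ger0_norm// subr_ge0.
    have /andP[h1 h2] := fine_normal_prob_itv (ltW h).
    by rewrite distrC ger0_norm// [in leRHS]distrC [in leRHS]ger0_norm// subr_ge0 ltW.
  have -> : r / s - r = - ((s ^+ 2 - 1) * r * (s * (s + 1))^-1).
    by field; apply/andP; split; lra.
  rewrite normrN !normrM mulrDl.
  apply: (@le_trans _ _ (2 * normal_peak 1 * `|r| * `|s ^+ 2 - 1|)); last first.
    by rewrite lerDl mulr_ge0.
  have -> : normal_peak 1 * (`|s ^+ 2 - 1| * `|r| * `|(s * (s + 1))^-1|) =
      `|(s * (s + 1))^-1| * (normal_peak 1 * `|r| * `|s ^+ 2 - 1|) by ring.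
  rewrite -!mulrA ler_wpM2r ?mulr_ge0 ?normal_peak_ge0//.
  rewrite ger0_norm ?invr_ge0; last by rewrite mulr_ge0; lra.
  rewrite invf_ple ?posrE; try lra; nra.
apply: (@le_trans _ _ 1).
  have h1 := fine_gaussian_cdf s r.
  have h2 : 0 <= fine (gamma `]-oo, r]) <= 1.
    by rewrite fine_ge0//= -lee_fin fineK ?fin//; apply: probability_le1.
  by rewrite ler_norml; lra.
have s2 : s ^+ 2 <= 1 / 4 by nra.
have -> : `|s ^+ 2 - 1| = 1 - s ^+ 2 by rewrite ler0_norm ?opprB//; lra.
rewrite mulrDl -[leLHS]add0r lerD//; last by lra.
by rewrite mulr_ge0// ?mulr_ge0 ?normal_peak_ge0//; lra.
Qed.
End moments.

(** * Linear combinations of Gaussians with independent coefficients *)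

Section independence.
Context {R : realType} {disp : measure_display} {Omega : measurableType disp}.
Context (P : probability Omega R) {T : choiceType} (D : set T).
Context (X : T -> {RV P >-> R}).
Implicit Types (J : {fset T}) (u v : T).
Local Notation gamma := (normal_prob (0 : R) 1).

(** The events that these sets generate are those decided by the variables with
    index in [J]. *)
Definition cylinder J : set (set Omega) := [set A | exists2 B : T -> set R,
  forall v, measurable (B v) & A = \bigcap_(v in [set` J]) X v @^-1` B v].

(** The same set [Omega] with a smaller sigma-algebra: conditioning on the
    variables in [J] is measurability on this space. *)
Definition sub_space J := g_sigma_algebraType (cylinder J).
HB.instance Definition _ J := Measurable.on (sub_space J).

Lemma cylinder_setI J : setI_closed (cylinder J).
Proof.
move=> _ _ [B mB ->] [C mC ->]; exists (fun v => B v `&` C v).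
  by move=> v; exact: measurableI.
by rewrite -bigcapI; apply: eq_bigcapr => v _; rewrite preimage_setI.
Qed.

Lemma measurable_cylinder J A : cylinder J A -> measurable A.
Proof.
move=> [B mB ->]; apply: fin_bigcap_measurable; first exact: finite_fset.
by move=> v _; rewrite -[X in measurable X]setTI; apply: measurable_funP.
Qed.

Lemma measurable_sub_space J (A : set (sub_space J)) : measurable A ->
  measurable (A : set Omega).
Proof.
by apply: smallest_sub; [exact: sigma_algebra_measurable|exact: measurable_cylinder].
Qed.

Lemma measurable_coordinate J v : v \in J ->
  measurable_fun setT (X v : sub_space J -> R).
Proof.
move=> vJ _ B mB; rewrite setTI; apply: sub_sigma_algebra.
exists (fun w => if w == v then B else setT) => [w|].
  by case: ifP.
apply/seteqP; split=> [w Bw z /= zJ|w]; first by case: eqVneq => // ->.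
by move=> /(_ v vJ) /=; rewrite eqxx.
Qed.

Lemma sub_space_mono J K (A : set Omega) : (J `<=` K)%fset ->
  measurable (A : set (sub_space J)) -> measurable (A : set (sub_space K)).
Proof.
move=> /fsubsetP JK; apply: smallest_sub; first exact: sigma_algebra_measurable.
move=> _ [B mB ->]; apply: sub_sigma_algebra.
exists (fun v => if v \in J then B v else setT) => [v|]; first by case: ifP.
apply/seteqP; split=> w h v /= vJ.
  by case: ifPn => // vJ'; exact: h.
by have := h v (JK _ vJ); rewrite vJ.
Qed.

Hypothesis iid : iid_standard_normal D X.

(** Cylinders form a pi-system on which the product rule is mutual independence;
    Dynkin induction extends it to all events decided by [J]. *)
Lemma independent_preimage J u (A : set Omega) (B : set R) :
  [set` J] `<=` D -> D u -> u \notin J ->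
  measurable (A : set (sub_space J)) -> measurable B ->
  P (A `&` X u @^-1` B) = (P A * gamma B)%E.
Proof.
move=> JD Du uJ mA mB.
have mXB : measurable (X u @^-1` B).
  by rewrite -[X in measurable X]setTI; apply: measurable_funP.
have PB : P (X u @^-1` B) = gamma B by case: iid => _ /(_ u Du B mB) <-.
have compl (S : set Omega) : measurable S ->
    P (S `&` X u @^-1` B) = (P S * P (X u @^-1` B))%E ->
    P (~` S `&` X u @^-1` B) = (P (~` S) * P (X u @^-1` B))%E.
  move=> mS PS.
  have -> : ~` S `&` X u @^-1` B = X u @^-1` B `\` (S `&` X u @^-1` B).
    by rewrite setDIr setDv setU0 setDE setIC.
  have mSB : measurable (S `&` X u @^-1` B) by exact: measurableI.
  rewrite measureD//; last by rewrite -ge0_fin_numE// fin_num_measure.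
  have -> : X u @^-1` B `&` (S `&` X u @^-1` B) = S `&` X u @^-1` B.
    by rewrite setICA setIid.
  transitivity (P (X u @^-1` B) - P S * P (X u @^-1` B))%E.
    by congr (_ - _)%E; exact: PS.
  rewrite probability_setC//.
  rewrite -(fineK (fin_num_measure P _ mS)) -(fineK (fin_num_measure P _ mXB)).
  by rewrite -EFinM -!EFinB -EFinM; congr EFin; ring.
have union (F : (set Omega)^nat) : (forall n, measurable (F n)) ->
    trivIset setT F ->
    (forall n, P (F n `&` X u @^-1` B) = (P (F n) * P (X u @^-1` B))%E) ->
    P ((\bigcup_k F k) `&` X u @^-1` B) =
    (P (\bigcup_k F k) * P (X u @^-1` B))%E.
  move=> mF tF PF; rewrite setI_bigcupl !measure_bigcup//=; last 2 first.
  - by move=> n _; exact: measurableI.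
  - exact: trivIset_setIr.
  under eq_eseriesr do rewrite PF muleC.
  by rewrite muleC -(fineK (fin_num_measure P _ mXB)) nneseriesZl.
rewrite -PB; move: A mA.
apply: (@dynkin_induction _ (sub_space J) (cylinder J)
  (fun A => P (A `&` X u @^-1` B) = (P A * P (X u @^-1` B))%E)).
- by [].
- exact: cylinder_setI.
- by rewrite setTI probability_setT mul1e.
- move=> _ [C mC ->]; case: iid => ind _.
  (* the cylinder [C] cut by [X u @^-1` B] is a cylinder over [u |` J] *)
  pose C' v := if v == u then B else C v.
  have C'u : C' u = B by rewrite /C' eqxx.
  have mC' v : measurable (C' v) by rewrite /C'; case: ifP.
  have eC v : v \in J -> C' v = C v.
    by rewrite /C'; case: eqVneq => // -> uJ'; rewrite uJ' in uJ.
  have := ind (u |` J)%fset C' _ (fun v _ => mC' v).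
  rewrite big_fsetU1//= C'u.
  have -> : \bigcap_(v in [set` (u |` J)%fset]) X v @^-1` C' v =
      (\bigcap_(v in [set` J]) X v @^-1` C v) `&` X u @^-1` B.
    apply/seteqP; split => [w h|w [h Bw] v /=].
      split; last by have := h u; rewrite /= !inE eqxx C'u; apply.
      by move=> v /= vJ; rewrite -eC//; apply: h; rewrite /= !inE vJ orbT.
    rewrite !inE => /orP[/eqP ->|vJ]; first by rewrite C'u.
    by rewrite eC//; exact: h.
  move=> ->; last by move=> v /=; rewrite !inE => /orP[/eqP ->//|/JD].
  rewrite muleC; congr (_ * _)%E; rewrite (ind J C)//.
  by apply: eq_big_seq => v vJ; rewrite eC.
- by move=> S mS; apply: compl; exact: (measurable_sub_space mS).
- by move=> F mF; apply: union => n; exact: (measurable_sub_space (mF n)).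
Qed.

Definition sub_id J : Omega -> sub_space J := id.

Lemma measurable_sub_id J : measurable_fun setT (sub_id J).
Proof.
by move=> _ B mB; rewrite setTI; exact: (@measurable_sub_space J).
Qed.

HB.instance Definition _ J := @isMeasurableFun.Build _ _ _ _
  (sub_id J) (@measurable_sub_id J).

(** The pair formed by the information in [J] and one further variable; by
    independence its law is a product measure. *)
Definition sub_pair J u (w : Omega) : sub_space J * measurableTypeR R :=
  (sub_id J w, X u w).

Lemma measurable_sub_pair J u : measurable_fun setT (sub_pair J u).
Proof.
apply: measurable_fun_pair; first exact: measurable_sub_id.
exact: (measurable_funP (X u)).
Qed.

HB.instance Definition _ J u := @isMeasurableFun.Build _ _ _ _
  (sub_pair J u) (@measurable_sub_pair J u).

Lemma distribution_sub_pair J u (A : set (sub_space J * measurableTypeR R)) :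
  [set` J] `<=` D -> D u -> u \notin J -> measurable A ->
  (distribution P (sub_id J) \x gamma)%E A = distribution P (sub_pair J u) A.
Proof.
move=> JD Du uJ mA; apply: (@product_measure_unique _ _ (sub_space J) _ _
  (distribution P (sub_id J)) gamma (distribution P (sub_pair J u))) => //.
move=> B C mB mC.
rewrite -[in RHS](independent_preimage JD Du uJ mB mC).
by rewrite /distribution/= /pushforward.
Qed.

Lemma ge0_integral_independent J u (G : sub_space J * measurableTypeR R -> \bar R) :
  [set` J] `<=` D -> D u -> u \notin J ->
  measurable_fun setT G -> (forall z, (0 <= G z)%E) ->
  (\int[P]_w G (w, X u w) = \int[P]_w \int[gamma]_x G (w, x))%E.
Proof.
move=> JD Du uJ mG G0.
transitivity (\int[distribution P (sub_pair J u)]_z G z)%E.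
  by rewrite ge0_integral_distribution.
transitivity (\int[(distribution P (sub_id J) \x gamma)%E]_z G z)%E.
  apply: eq_measure_integral => A mA _; symmetry.
  exact: distribution_sub_pair.
rewrite fubini_tonelli1// ge0_integral_distribution//.
  exact: measurable_fun_fubini_tonelli_F.
by move=> y; apply: integral_ge0.
Qed.

(** The signed case of [ge0_integral_independent] needs integrability of the
    product, which is obtained from the nonnegative case. *)
Lemma integral_independent_mul J u (A : sub_space J -> R) (h : R -> R) :
  [set` J] `<=` D -> D u -> u \notin J ->
  measurable_fun setT A -> measurable_fun setT h ->
  P.-integrable setT (fun w => (A w)%:E) -> gamma.-integrable setT (fun x => (h x)%:E) ->
  P.-integrable setT (fun w => (A w * h (X u w))%:E) /\
  (\int[P]_w (A w * h (X u w))%:E =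
   \int[P]_w (A w)%:E * \int[gamma]_x (h x)%:E)%E.
Proof.
move=> JD Du uJ mA mh iA ih.
pose G (z : sub_space J * measurableTypeR R) := (A z.1 * h z.2)%:E.
have mG : measurable_fun setT G.
  apply/measurable_EFinP; apply: measurable_funM.
    exact: measurableT_comp.
  exact: measurableT_comp.
have A_fin : (\int[P]_w (A w)%:E)%E \is a fin_num by exact: integrable_fin_num.
have h_fin : (\int[gamma]_x (h x)%:E)%E \is a fin_num by exact: integrable_fin_num.
have mP : measurable_fun setT (fun w : Omega => (A w * h (X u w))%:E).
  by apply: (measurableT_comp mG (@measurable_sub_pair J u)).
have iP : P.-integrable setT (fun w => (A w * h (X u w))%:E).
  apply/integrableP; split => //.
  rewrite (ge0_integral_independent (G := fun z => `|G z|%E) JD Du uJ)//; last first.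
    exact: measurableT_comp.
  rewrite (eq_integral (fun w : Omega => `|(A w)%:E| * \int[gamma]_x `|(h x)%:E|)%E); last first.
    move=> w _; rewrite -ge0_integralZl//; last first.
      by apply: measurableT_comp => //; exact/measurable_EFinP.
    by apply: eq_integral => x _; rewrite /G EFinM abseM.
  rewrite ge0_integralZr//; last 2 first.
  - apply: measurableT_comp => //; apply/measurable_EFinP.
    exact: (measurableT_comp mA (@measurable_sub_id J)).
  - by apply: integral_ge0.
  case/integrableP : iA => _ iA; case/integrableP : ih => _ ih.
  by apply: lte_mul_pinfty => //; [apply: integral_ge0|rewrite ge0_fin_numE//; apply: integral_ge0].
split => //.
have iQ : (distribution P (sub_pair J u)).-integrable setT G.
  by apply: integrable_pushforward => //.
transitivity (\int[distribution P (sub_pair J u)]_z G z)%E.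
  by rewrite integral_distribution.
transitivity (\int[(distribution P (sub_id J) \x gamma)%E]_z G z)%E.
  apply: eq_measure_integral => B mB _; symmetry.
  exact: distribution_sub_pair.
have iQ' : (distribution P (sub_id J) \x gamma)%E.-integrable setT G.
  case/integrableP : iQ => _ iQ; apply/integrableP; split => //.
  apply: le_lt_trans iQ; rewrite le_eqVlt; apply/orP; left; apply/eqP.
  apply: eq_measure_integral => B mB _; exact: distribution_sub_pair.
rewrite -integral12_prod_meas1//.
transitivity (\int[distribution P (sub_id J)]_w
    ((A w)%:E * \int[gamma]_x (h x)%:E))%E.
  apply: eq_integral => w _; rewrite /fubini_F -integralZl//.
have iAc : P.-integrable setT (fun w => ((A w)%:E * \int[gamma]_x (h x)%:E)%E).
  by rewrite -(fineK h_fin); apply: integrableZr.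
rewrite integral_distribution//; last first.
  rewrite -(fineK h_fin); apply: emeasurable_funM => //; exact/measurable_EFinP.
by rewrite -(fineK h_fin) integralZr.
Qed.

Lemma measurable_fun_sub_space_mono J K (f : Omega -> R) : (J `<=` K)%fset ->
  measurable_fun setT (f : sub_space J -> R) ->
  measurable_fun setT (f : sub_space K -> R).
Proof.
move=> JK mf _ B mB; apply: (sub_space_mono JK); exact: mf.
Qed.

Lemma measurable_fun_sub_space J (f : Omega -> R) :
  measurable_fun setT (f : sub_space J -> R) -> measurable_fun setT f.
Proof. by move=> mf _ B mB; apply: (@measurable_sub_space J); exact: mf. Qed.

(** Conditionally on the variables in [J], a linear combination of further
    variables is normal.  In the induction one variable [X u] is first counted
    as known, which enlarges [J], and is then integrated out by
    [gaussian_cdf_mix]. *)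
Lemma gaussian_mixture (s : seq T) J (a : T -> Omega -> R) (b : Omega -> R) :
  uniq s -> [set` J] `<=` D -> (forall u, u \in s -> D u /\ u \notin J) ->
  (forall u, measurable_fun setT (a u : sub_space J -> R)) ->
  measurable_fun setT (b : sub_space J -> R) ->
  P [set w | \sum_(u <- s) a u w * X u w <= b w] =
  (\int[P]_w gaussian_cdf (Num.sqrt (\sum_(u <- s) a u w ^+ 2)) (b w))%E.
Proof.
elim: s J a b => [|u s IH] J a b /=.
  move=> _ _ _ _ mb.
  set E := [set w | _].
  have mE : measurable E.
    rewrite (_ : E = b @^-1` `[0, +oo[); last first.
      by apply/seteqP; split => w; rewrite /E/= big_nil in_itv/= andbT.
    rewrite -[X in measurable X]setTI.
    exact: (measurable_fun_sub_space mb).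
  transitivity (\int[P]_w (\1_E w)%:E)%E; first by rewrite integral_indic ?setIT.
  apply: eq_integral => w _; rewrite big_nil sqrtr0 gaussian_cdf0 indicE.
  congr (nat_of_bool _)%:R%:E; apply/idP/idP => [/set_mem|h]; first by rewrite /E/= big_nil.
  by apply: mem_set; rewrite /E/= big_nil.
move=> /andP[us s_uniq] JD sD ma mb.
have [Du uJ] := sD u (mem_head _ _).
pose K := (u |` J)%fset.
have JK : (J `<=` K)%fset by exact: fsubsetUr.
have maK v := measurable_fun_sub_space_mono JK (ma v).
have mbK := measurable_fun_sub_space_mono JK mb.
have muK : measurable_fun setT (X u : sub_space K -> R).
  by apply: measurable_coordinate; rewrite !inE eqxx.
have -> : [set w | \sum_(v <- u :: s) a v w * X v w <= b w] =
    [set w | \sum_(v <- s) a v w * X v w <= b w - a u w * X u w].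
  by apply/seteqP; split => w /=; rewrite big_cons lerBrDr addrC.
rewrite (IH K); last 5 first.
- exact: s_uniq.
- by move=> v /=; rewrite !inE => /orP[/eqP->//|/JD].
- move=> v vs; have [|Dv vJ] := sD v; first by rewrite inE vs orbT.
  split=> //.
  by rewrite !inE negb_or vJ andbT; apply: contraNneq us => <-.
- exact: maK.
- by apply: measurable_funB => //; exact: measurable_funM.
pose sg w := Num.sqrt (\sum_(v <- s) a v w ^+ 2).
have msg : measurable_fun setT (sg : sub_space J -> R).
  apply: (@measurableT_comp _ _ _ _ _ _ (@Num.sqrt R)); last first.
    by apply: measurable_sum => v; exact: measurable_funX.
  apply: continuous_measurable_fun; exact: sqrt_continuous.
pose G (z : sub_space J * measurableTypeR R) := gaussian_cdf (sg z.1) (b z.1 - a u z.1 * z.2).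
pose F (z : sub_space J * measurableTypeR R) : R * R := (sg z.1, b z.1 - a u z.1 * z.2).
have mF : measurable_fun setT F.
  apply: measurable_fun_pair; first exact: measurableT_comp.
  apply: measurable_funB; first exact: measurableT_comp.
  apply: measurable_funM; first exact: measurableT_comp.
  exact: measurable_snd.
transitivity (\int[P]_w G (w, X u w))%E; first by [].
rewrite ge0_integral_independent//; last first.
  exact: (measurableT_comp measurable_gaussian_cdf mF).
apply: eq_integral => w _; rewrite /G/= gaussian_cdf_mix big_cons /sg.
by rewrite sqr_sqrtr ?sumr_ge0// 1?addrC// => v _; rewrite sqr_ge0.
Qed.

Lemma expectation_monomial (s : seq T) (k : T -> nat) :
  uniq s -> (forall u, u \in s -> D u) ->
  P.-integrable setT (fun w => (\prod_(v <- s) X v w ^+ k v)%:E) /\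
  (\int[P]_w (\prod_(v <- s) X v w ^+ k v)%:E =
   (\prod_(v <- s) gaussian_moment (R := R) (k v))%:E)%E.
Proof.
elim: s => [|u s IH] /=.
  move=> _ _; split.
    under eq_fun do rewrite big_nil.
    exact: finite_measure_integrable_cst.
  under eq_integral do rewrite big_nil.
  by rewrite integral_cst//= probability_setT mul1e big_nil.
move=> /andP[us s_uniq] sD.
have [|iA EA] := IH s_uniq; first by move=> v vs; apply: sD; rewrite inE vs orbT.
pose J := [fset v in s]%fset.
have mA : measurable_fun setT
    ((fun w => \prod_(v <- s) X v w ^+ k v) : sub_space J -> R).
  apply: measurable_prod => v vs; apply: measurable_funX.
  by apply: measurable_coordinate; rewrite inE.
have eq_prod w : \prod_(v <- u :: s) X v w ^+ k v =
    (\prod_(v <- s) X v w ^+ k v) * X u w ^+ k u.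
  by rewrite big_cons mulrC.
have := @integral_independent_mul J u _ (fun x => x ^+ k u) _ _ _ mA _ iA.
case.
- by move=> v /=; rewrite inE => vs; apply: sD; rewrite inE vs orbT.
- by apply: sD; rewrite mem_head.
- by rewrite inE.
- exact: measurable_pow.
- exact: integrable_normal_pow.
move=> i1 E1; split.
  by under eq_fun do rewrite eq_prod.
under eq_integral do rewrite eq_prod.
by rewrite E1 EA gaussian_momentE -EFinM big_cons mulrC.
Qed.

End independence.

Local Close Scope classical_set_scope.

(** * Finner inequality on a finite product *)

Section coordinate_average.
Context {R : realType} {C A : finType}.
Local Notation Y := {ffun C -> A}.
Implicit Types (y : Y) (j k : C) (x : A) (g h : Y -> R).

Definition update y j x : Y := [ffun k => if k == j then x else y k].

Definition average_at j g y : R := #|A|%:R^-1 * \sum_x g (update y j x).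

Definition insensitive j g := forall y x, g (update y j x) = g y.

Lemma updateK y j x x' : update (update y j x) j x' = update y j x'.
Proof. by apply/ffunP => k; rewrite !ffunE; case: (k == j). Qed.

Lemma updateC y j x k x' : j != k ->
  update (update y j x) k x' = update (update y k x') j x.
Proof.
move=> jk; apply/ffunP => l; rewrite !ffunE.
by case: (eqVneq l k) => // ->; rewrite eq_sym (negbTE jk).
Qed.

Lemma update_id y j : update y j (y j) = y.
Proof. by apply/ffunP => k; rewrite ffunE; case: eqVneq => // ->. Qed.

Lemma average_at_ge0 j g y : (forall y, 0 <= g y) -> 0 <= average_at j g y.
Proof. move=> g0; apply: mulr_ge0; first by rewrite invr_ge0 ler0n.
by apply: sumr_ge0 => x _. Qed.

Lemma average_at_insensitive j g : insensitive j (average_at j g).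
Proof.
by move=> y x; rewrite /average_at; under eq_bigr do rewrite updateK.
Qed.

Hypothesis A0 : (0 < #|A|)%N.

Lemma average_at_id j g y : insensitive j g -> average_at j g y = g y.
Proof.
move=> gj; rewrite /average_at; under eq_bigr do rewrite gj.
by rewrite sumr_const -[g y *+ _]mulr_natl mulKf// pnatr_eq0 -lt0n.
Qed.

Lemma average_at_stable j k g : insensitive j g -> insensitive j (average_at k g).
Proof.
move=> gj; have [<-|jk] := eqVneq j k; first exact: average_at_insensitive.
move=> y x; rewrite /average_at; congr (_ * _); apply: eq_bigr => x' _.
by rewrite updateC// gj.
Qed.

(** Exchanging the value at [j] with a fresh value is an involution of the set
    of pairs of a function and a value. *)
Lemma sum_average_at j g : \sum_y average_at j g y = \sum_y g y.
Proof.
rewrite -big_distrr/= pair_big/=.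
pose h (p : Y * A) := (update p.1 j p.2, p.1 j).
have hK : involutive h.
  by move=> [y x]; rewrite /h/= updateK update_id ffunE eqxx.
rewrite (reindex_inj (inv_inj hK))/=.
under eq_bigr do rewrite updateK update_id.
rewrite -(pair_big xpredT xpredT (fun y (_ : A) => g y))/=.
rewrite exchange_big/= sumr_const -[(\sum_(i | _) _) *+ _]mulr_natl mulKf// pnatr_eq0 -lt0n//.
Qed.

Definition averages (s : seq C) g : Y -> R := foldr average_at g s.

Lemma averages_ge0 s g y : (forall y, 0 <= g y) -> 0 <= averages s g y.
Proof. by move=> g0; elim: s y => //= j s IH y; exact: average_at_ge0. Qed.

Lemma averages_stable j s g : insensitive j g -> insensitive j (averages s g).
Proof. by move=> gj; elim: s => //= k s IH; exact: average_at_stable. Qed.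

Lemma averages_insensitive j s g : j \in s -> insensitive j (averages s g).
Proof.
elim: s => //= k s IH; rewrite inE => /predU1P[->|js].
  exact: average_at_insensitive.
by apply: average_at_stable; exact: IH.
Qed.

Lemma sum_averages s g : \sum_y averages s g y = \sum_y g y.
Proof. by elim: s => //= j s <-; exact: sum_average_at. Qed.

Lemma insensitive_constant g : (forall j, insensitive j g) ->
  forall y z, g y = g z.
Proof.
move=> gi y z.
have E (s : seq C) : g y = g [ffun k => if k \in s then z k else y k].
  elim: s => [|j s IH]; first by congr g; apply/ffunP => k; rewrite ffunE.
  rewrite IH -(gi j _ (z j)); congr g; apply/ffunP => k; rewrite !ffunE inE.
  by case: eqVneq => // ->.
by rewrite (E (enum C)); congr g; apply/ffunP => k; rewrite ffunE mem_enum.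
Qed.

Lemma averages_enum g y : averages (enum C) g y = (#|{: Y}|%:R)^-1 * \sum_z g z.
Proof.
rewrite -(sum_averages (enum C)).
rewrite (eq_bigr (fun=> averages (enum C) g y)).
  rewrite sumr_const -[averages _ _ _ *+ _]mulr_natl mulKf// pnatr_eq0 -lt0n.
  by apply/card_gt0P; exists y.
move=> z _; apply: insensitive_constant => j.
by apply: averages_insensitive; rewrite mem_enum.
Qed.

End coordinate_average.

Section finner.
Context {R : realType} {C A I : finType} (b : nat) (S : I -> {set C}).
Local Notation Y := {ffun C -> A}.
Hypothesis A0 : (0 < #|A|)%N.
Hypothesis b0 : (0 < b)%N.
Hypothesis cover_b : forall j, #|[set i | j \in S i]| = b.
Local Notation root r := (r `^ (b%:R^-1 : R)).

(** Arithmetic-geometric means. *)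
Lemma prod_root_le_mean (J : {set I}) (v : I -> R) :
  #|J| = b -> (forall i, 0 <= v i) ->
  \prod_(i in J) root (v i) <= b%:R^-1 * \sum_(i in J) v i.
Proof.
move=> Jb v0.
have := @leif_AGM _ _ (mem J) v (fun i _ => v0 i).
rewrite Jb => -[h _].
have bR : 0 < (b%:R : R) by rewrite ltr0n.
have s0 : 0 <= (\sum_(i in J) v i) / b%:R.
  by apply: mulr_ge0; [apply: sumr_ge0 => i _|rewrite invr_ge0 ler0n].
have -> : \prod_(i in J) root (v i) = root (\prod_(i in J) v i).
  suff [_ ->] : 0 <= \prod_(i in J) v i /\
    \prod_(i in J) root (v i) = root (\prod_(i in J) v i) by [].
  elim/big_rec2 : _ => [|i x y _ [y0 ->]]; first by rewrite powR1.
  by rewrite mulr_ge0 ?powRM.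
have h' : root (\prod_(i in J) v i) <= root (((\sum_(i in J) v i) / b%:R) ^+ b).
  apply: ge0_ler_powR h; first by rewrite invr_ge0 ltW.
    by rewrite nnegrE; apply: prodr_ge0.
  by rewrite nnegrE; apply: exprn_ge0.
apply: (le_trans h').
by rewrite -powR_mulrn// -powRrM divff ?gt_eqF// powRr1// mulrC.
Qed.

(** Hoelder inequality for [b] functions with equal exponents: after division by
    the means, it is the average of [prod_root_le_mean]. *)
Lemma holder_average (J : {set I}) (u : I -> A -> R) :
  #|J| = b -> (forall i x, 0 <= u i x) ->
  #|A|%:R^-1 * \sum_x \prod_(i in J) root (u i x) <=
  \prod_(i in J) root (#|A|%:R^-1 * \sum_x u i x).
Proof.
move=> Jb u0.
pose m i := #|A|%:R^-1 * \sum_x u i x.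
have m0 i : 0 <= m i.
  by rewrite /m; apply: mulr_ge0; [rewrite invr_ge0 ler0n|apply: sumr_ge0 => x _].
have AR : 0 < (#|A|%:R : R) by rewrite ltr0n.
have [mpos|] := boolP [forall i in J, 0 < m i]; last first.
  rewrite negb_forall_in => /existsP[i /andP[iJ]]; rewrite -leNgt => mi.
  have {mi} mi : m i = 0 by apply/le_anti; rewrite mi m0.
  have ui x : u i x = 0.
    move/eqP : mi; rewrite mulf_eq0 invr_eq0 gt_eqF//= psumr_eq0//.
    by move/allP => /(_ x (mem_index_enum _))/eqP.
  rewrite big1 ?mulr0.
    by apply: prodr_ge0 => k _; exact: powR_ge0.
  move=> x _; rewrite (bigD1 i)//= ui powR0 ?mul0r//.
  by rewrite invr_neq0// pnatr_eq0 -lt0n.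
move/forall_inP : mpos => mpos.
have E x : \prod_(i in J) root (u i x) <=
    (\prod_(i in J) root (m i)) * (b%:R^-1 * \sum_(i in J) u i x / m i).
  have -> : \prod_(i in J) root (u i x) =
      (\prod_(i in J) root (m i)) * \prod_(i in J) root (u i x / m i).
    rewrite -big_split/=; apply: eq_bigr => i iJ.
    rewrite -powRM; [|exact: m0|by apply: mulr_ge0; rewrite ?invr_ge0].
    by rewrite mulrC divfK// gt_eqF// mpos.
  rewrite ler_wpM2l//; first by apply: prodr_ge0 => k _; exact: powR_ge0.
  by apply: prod_root_le_mean => // i; rewrite mulr_ge0 ?invr_ge0.
apply: (@le_trans _ _ (#|A|%:R^-1 * \sum_x ((\prod_(i in J) root (m i)) *
    (b%:R^-1 * \sum_(i in J) u i x / m i)))).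
  by rewrite ler_wpM2l ?invr_ge0// ler_sum.
rewrite -mulr_sumr mulrCA ler_piMr//.
  by apply: prodr_ge0 => k _; exact: powR_ge0.
rewrite -mulr_sumr exchange_big/= mulrCA mulr_sumr.
under eq_bigr => i iJ.
  rewrite -mulr_suml mulrA -/(m i) divff ?gt_eqF ?mpos//.
  over.
by rewrite sumr_const Jb -[1 *+ b]/(b%:R) mulVf// pnatr_eq0 -lt0n.
Qed.

(** Averaging over one coordinate: the factors that do not see it come out, and
    there are exactly [b] others, to which [holder_average] applies. *)
Lemma average_prod_root (h : I -> Y -> R) j y :
  (forall i y, 0 <= h i y) -> (forall i, j \notin S i -> insensitive j (h i)) ->
  average_at j (fun y => \prod_i root (h i y)) y <=
  \prod_i root (average_at j (h i) y).
Proof.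
move=> h0 hj.
have split_prod (F : I -> R) : \prod_i F i =
    (\prod_(i in [set i | j \in S i]) F i) * \prod_(i in [set i | j \notin S i]) F i.
  rewrite (bigID (mem [set i | j \in S i]))/=; congr (_ * _);
    by apply: eq_bigl => i; rewrite !inE.
rewrite [leRHS]split_prod /average_at.
rewrite (eq_bigr (fun x => (\prod_(i in [set i | j \in S i]) root (h i (update y j x)))
   * \prod_(i in [set i | j \notin S i]) root (h i y))); last first.
  move=> x _; rewrite split_prod; congr (_ * _); apply: eq_bigr => i; rewrite inE => jS.
  by rewrite hj.
rewrite -mulr_suml mulrA ler_pM//.
- apply: mulr_ge0; first by rewrite invr_ge0 ler0n.
  by apply: sumr_ge0 => x _; apply: prodr_ge0 => i _; exact: powR_ge0.
- by apply: prodr_ge0 => i _; exact: powR_ge0.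
- exact: holder_average.
- rewrite le_eqVlt; apply/orP; left; apply/eqP; apply: eq_bigr => i; rewrite inE => jS.
  rewrite -[in RHS]/(average_at j (h i) y) average_at_id//; exact: hj.
Qed.

(** Averaging over the coordinates one after the other with
    [average_prod_root], each factor becomes constant, equal to its mean. *)
Lemma finner_inequality (h : I -> Y -> R) :
  (forall i y, 0 <= h i y) ->
  (forall i j, j \notin S i -> insensitive j (h i)) ->
  #|{: Y}|%:R^-1 * \sum_y \prod_i root (h i y) <=
  \prod_i root (#|{: Y}|%:R^-1 * \sum_y h i y).
Proof.
move=> h0 hS.
have step s : \sum_y \prod_i root (h i y) <=
    \sum_y \prod_i root (averages s (h i) y).
  elim: s => //= j s IH; apply: (le_trans IH).
  rewrite -(sum_average_at A0 j); apply: ler_sum => y _.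
  apply: (@average_prod_root (fun i => averages s (h i))).
    by move=> i z; exact: averages_ge0.
  by move=> i ji; apply: averages_stable => //; exact: hS.
have [y0 _] : exists y0 : Y, True.
  by case/card_gt0P : A0 => x _; exists [ffun=> x].
have Y0 : 0 < (#|{: Y}|%:R : R) by rewrite ltr0n; apply/card_gt0P; exists y0.
rewrite mulrC ler_pdivrMr//; apply: (le_trans (step (enum C))).
have E : \sum_y \prod_i root (averages (enum C) (h i) y) =
    \sum_(y : Y) \prod_i root (#|{: Y}|%:R^-1 * \sum_z h i z).
  by apply: eq_bigr => y _; apply: eq_bigr => i _; rewrite averages_enum.
by rewrite E sumr_const -[leLHS]mulr_natr.
Qed.

End finner.

(** * Fractional Cartesian products *)

Lemma card_ffun_in (C A : finType) (B : C -> {set A}) :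
  #|[set f : {ffun C -> A} | [forall j, f j \in B j]]| = (\prod_j #|B j|)%N.
Proof.
have := @card_family C (fun=> A) (fun j => mem (B j)).
rewrite foldrE big_map big_enum /= => <-.
by apply: eq_card => f; rewrite inE unfold_in.
Qed.

(** The number of coordinates is a successor because ['I_d'.+1] is then a cyclic
    group for the addition modulo [d'.+1]. *)
Section construction.
Variables (d' b : nat).
Local Notation d := d'.+1.
Hypothesis b_gt1 : (1 < b)%N.
Hypothesis b_le : (b <= d)%N.
Implicit Types (i j : 'I_d).

(** An interval of [b] consecutive points of the cyclic group, starting at [i]. *)
Definition window i : {set 'I_d} := [set j | (nat_of_ord (j - i)%R < b)%N].

Lemma card_ord_lt : #|[set i : 'I_d | (i < b)%N]| = b.
Proof.
have wi : injective (widen_ord b_le) by move=> i j /(congr1 val) /= /val_inj.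
rewrite -[RHS]card_ord -(card_imset _ wi).
apply: eq_card => i; rewrite !inE; apply/idP/imsetP => [ib|[k _ ->]].
  by exists (Ordinal ib) => //; exact: val_inj.
by rewrite /= ltn_ord.
Qed.

Lemma card_window i : #|window i| = b.
Proof.
rewrite -[RHS]card_ord_lt -[RHS](card_imset _ (addIr i)).
apply: eq_card => j; rewrite [LHS]inE; apply/idP/imsetP => [ji|[k]].
  by exists (j - i); rewrite ?inE// subrK.
by rewrite inE => ? ->; rewrite addrK.
Qed.

Lemma window_cover j : #|[set i | j \in window i]| = b.
Proof.
rewrite -[RHS]card_ord_lt -[RHS](card_imset _ (can_inj (@subKr _ j))).
apply: eq_card => i; rewrite [LHS]inE inE; apply/idP/imsetP => [ji|[k]].
  by exists (j - i); rewrite ?inE// subKr.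
by rewrite inE => ? ->; rewrite subKr.
Qed.

Lemma window_self i : i \in window i.
Proof. by rewrite inE subrr/= (ltn_trans _ b_gt1). Qed.

(** Here [b > 1] matters: consecutive windows overlap. *)
Lemma window_next i (hi : (i.+1 < d)%N) :
  Ordinal hi \in window i :&: window (Ordinal hi).
Proof.
rewrite inE window_self andbT inE.
have -> : Ordinal hi - i = inord 1.
  apply/eqP; rewrite subr_eq; apply/eqP/val_inj => /=.
  have d1 : (1 < d)%N := leq_ltn_trans (leq0n i) hi.
  by rewrite inordK// add1n modn_small.
rewrite inordK//; exact: leq_ltn_trans (leq0n i) hi.
Qed.

(** A vertex is a window together with a function that vanishes outside it.  The
    type does not depend on the number of values, so that it can host the
    whole sequence of vertex sets. *)
Definition vertex_type := ('I_d * {ffun 'I_d -> nat})%type.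

Section size.
Variable N' : nat.
Local Notation N := N'.+1.
Local Notation Y := {ffun 'I_d -> 'I_N}.
Implicit Types (y z : Y).

Definition mask i y : {ffun 'I_d -> nat} :=
  [ffun j => if j \in window i then nat_of_ord (y j) else 0%N].

Lemma mask_eqP i y z :
  reflect (forall j, j \in window i -> y j = z j) (mask i y == mask i z).
Proof.
apply: (iffP eqP) => [/ffunP E j ji|E].
  by have := E j; rewrite !ffunE ji => /val_inj.
by apply/ffunP => j; rewrite !ffunE; case: ifP => // /E ->.
Qed.

Definition vertex i y : vertex_type := (i, mask i y).

Definition vertices : {fset vertex_type} :=
  [fset v in [seq vertex p.1 p.2 | p <- enum {: 'I_d * Y}]]%fset.

Definition edge (p : 'S_d * Y) : d.-tuple vertex_type :=
  [tuple vertex (p.1 k) p.2 | k < d].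

Definition edges : {fset d.-tuple vertex_type} :=
  [fset t in [seq edge p | p <- enum {: 'S_d * Y}]]%fset.

(** The tags of the vertices give back the permutation, and the windows cover
    all coordinates. *)
Lemma edge_inj : injective edge.
Proof.
move=> [s y] [s' y'] /(congr1 (fun t => tnth t)) E.
have E' k : (s k, mask (s k) y) = (s' k, mask (s' k) y').
  by have := congr1 (fun f => f k) E; rewrite !tnth_mktuple.
have ss' : s = s' by apply/permP => k; case: (E' k).
congr pair => //; apply/ffunP => j.
have [_ /eqP] := E' ((s^-1)%g j).
by rewrite -ss' permKV => /mask_eqP; apply; exact: window_self.
Qed.

Lemma mem_vertex i y : vertex i y \in vertices.
Proof. by rewrite inE; apply/mapP; exists (i, y); rewrite ?mem_enum. Qed.

Lemma mem_verticesP v : v \in vertices -> exists i y, v = vertex i y.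
Proof. by rewrite inE => /mapP[[i y] _ ->]; exists i, y. Qed.

Lemma mem_edge p : edge p \in edges.
Proof. by rewrite inE; apply: map_f; rewrite mem_enum. Qed.

Lemma mem_edgesP t : t \in edges -> exists p, t = edge p.
Proof. by rewrite inE => /mapP[p _ ->]; exists p. Qed.

Lemma perm_edges : perm_eq edges [seq edge p | p <- enum {: 'S_d * Y}].
Proof.
apply: uniq_perm; first exact: fset_uniq.
  by rewrite (map_inj_uniq edge_inj) enum_uniq.
by move=> t; rewrite inE.
Qed.

Lemma card_Y : #|{: Y}| = (N ^ d)%N.
Proof. by rewrite card_ffun !card_ord. Qed.

Lemma card_edges : #|` edges|%fset = (d`! * N ^ d)%N.
Proof.
by rewrite (perm_size perm_edges) size_map -cardE card_prod card_Sn card_Y.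
Qed.

Lemma card_mask_fiber i y : #|[set z | mask i z == mask i y]| = (N ^ (d - b))%N.
Proof.
pose B j := if j \in window i then [set y j] else [set: 'I_N].
have -> : [set z | mask i z == mask i y] = [set z : Y | [forall j, z j \in B j]].
  apply/setP => z; rewrite !inE; apply/mask_eqP/forallP => E j.
    by rewrite /B; case: ifP => [/E ->|_]; rewrite inE.
  by move=> ji; have := E j; rewrite /B ji inE => /eqP.
rewrite card_ffun_in (bigID (mem (window i)))/=.
rewrite big1 ?mul1n; last by move=> j ji; rewrite /B ji cards1.
rewrite (eq_bigr (fun=> N)); last first.
  by move=> j ji; rewrite /B (negbTE ji) cardsT card_ord.
rewrite prod_nat_const; congr (_ ^ _)%N.
have := cardC (mem (window i)); rewrite card_window card_ord => Ed.
by apply/eqP; rewrite -(eqn_add2l b) Ed subnKC.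
Qed.

Definition masks i : seq {ffun 'I_d -> nat} := undup [seq mask i y | y : Y].

Lemma mem_masks i y : mask i y \in masks i.
Proof. by rewrite mem_undup; apply: map_f; rewrite mem_enum. Qed.

Lemma mem_masksP i f : f \in masks i -> exists y, f = mask i y.
Proof. by rewrite mem_undup => /mapP[y _ ->]; exists y. Qed.

Lemma sum_masks i (F : {ffun 'I_d -> nat} -> nat) :
  (\sum_(y : Y) F (mask i y) = N ^ (d - b) * \sum_(f <- masks i) F f)%N.
Proof.
have fiber f : f \in masks i -> (\sum_(y : Y) (mask i y == f) = N ^ (d - b))%N.
  move=> /mem_masksP[z ->]; rewrite -(card_mask_fiber i z) -sum1_card big_mkcond/=.
  by rewrite [RHS]big_mkcond; apply: eq_bigr => y _; rewrite inE; case: eqP.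
have one y : (\sum_(f <- masks i) (mask i y == f) * F f = F (mask i y))%N.
  rewrite (bigD1_seq (mask i y))/= ?mem_masks ?undup_uniq// eqxx mul1n.
  by rewrite big1 ?addn0// => f; rewrite eq_sym => /negbTE ->.
rewrite (eq_bigr _ (fun y _ => esym (one y))).
rewrite exchange_big/= big_seq big_distrr/= [RHS]big_seq; apply: eq_bigr => f fm.
by rewrite -big_distrl/= fiber.
Qed.

Lemma size_masks i : size (masks i) = (N ^ b)%N.
Proof.
have NN : (0 < N ^ (d - b))%N by rewrite expn_gt0.
apply/eqP; rewrite -(eqn_pmul2r NN) -expnD subnKC// -card_Y -sum1_card.
by rewrite (sum_masks i (fun=> 1)) big_const_seq count_predT iter_addn_0 mul1n mulnC.
Qed.

Lemma card_vertices : #|` vertices|%fset = (d * N ^ b)%N.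
Proof.
have pv : perm_eq vertices [seq (i, f) | i <- enum 'I_d, f <- masks i].
  apply: uniq_perm; first exact: fset_uniq.
    apply: allpairs_uniq_dep; first exact: enum_uniq.
    - by move=> i _; exact: undup_uniq.
    - by move=> [i f] [j g] _ _ /= [-> ->].
  move=> v; apply/idP/allpairsPdep => [/mem_verticesP[i [y ->]]|].
    by exists i, (mask i y); rewrite mem_enum mem_masks.
  by move=> [i [f [_ /mem_masksP[y ->] ->]]]; exact: mem_vertex.
rewrite (perm_size pv) size_allpairs_dep.
rewrite (eq_map (g := fun=> (N ^ b)%N)); last by move=> i; exact: size_masks.
by rewrite sumnE big_map big_const_seq count_predT iter_addn_0 size_enum_ord mulnC.
Qed.

Lemma in_power_edges : in_power vertices edges.
Proof.
by move=> t /mem_edgesP[p ->] k; rewrite tnth_mktuple; exact: mem_vertex.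
Qed.

Lemma symmetric_edges : symmetric_set edges.
Proof.
move=> t s /mem_edgesP[[p y] ->].
have -> : [tuple tnth (edge (p, y)) (s k) | k < d] = edge ((s * p)%g, y).
  by apply: eq_from_tnth => k; rewrite !tnth_mktuple /= permM.
exact: mem_edge.
Qed.

Lemma non_diagonal_edges : non_diagonal edges.
Proof.
move=> t /mem_edgesP[[p y] ->] k l kl; rewrite !tnth_mktuple /=.
by apply: contraNneq kl => -[/perm_inj ->].
Qed.

Section dimension.
Context {R : realType}.
Variable A : 'I_d -> {fset vertex_type}.
Let M := (\max_(i < d) #|` A i|)%N.

Lemma card_boxE :
  #|` box edges A|%fset =
  (\sum_(s : 'S_d) \sum_(y : Y) [forall k, vertex (s k) y \in A k])%N.
Proof.
rewrite pair_big/= card_fset_sum1 big_fset/= (perm_big _ perm_edges)/= big_map.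
rewrite big_mkcond big_enum/=; apply: eq_bigr => -[s y] _.
have -> : [forall k, tnth (edge (s, y)) k \in A k] = [forall k, vertex (s k) y \in A k].
  by apply: eq_forallb => k; rewrite tnth_mktuple.
by case: forallP.
Qed.

Lemma sum_vertex_in i (B : {fset vertex_type}) :
  (\sum_(y : Y) (vertex i y \in B) <= N ^ (d - b) * #|` B|)%N.
Proof.
rewrite (sum_masks i (fun f => (i, f) \in B)) leq_mul2l; apply/orP; right.
rewrite (eq_bigr (fun f => if (i, f) \in B then 1 else 0)%N); last first.
  by move=> f _; case: (_ \in _).
rewrite -big_mkcond sum1_count -size_filter -(size_map (pair i)).
apply: uniq_leq_size.
  by rewrite map_inj_uniq ?filter_uniq ?undup_uniq// => f g [].
by move=> v /mapP[f]; rewrite mem_filter => /andP[? _] ->.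
Qed.

(** For each ordering of the vertices this is [finner_inequality] for the
    indicator functions of the sides of the box, which are their own roots. *)
Lemma box_bound :
  #|` box edges A|%:R <= d`!%:R * M%:R `^ (d%:R / b%:R) :> R.
Proof.
have b0 : (0 < b)%N := ltnW b_gt1.
have N0 : 0 < (N%:R : R) by rewrite ltr0n.
rewrite card_boxE natr_sum.
have -> : d`!%:R * M%:R `^ (d%:R / b%:R) = \sum_(s : 'S_d) (M%:R `^ (d%:R / b%:R) : R).
  by rewrite sumr_const card_Sn mulr_natl.
apply: ler_sum => s _.
pose h i y : R := (vertex i y \in A ((s^-1)%g i))%:R.
have hroot i y : h i y = h i y `^ (b%:R^-1).
  by rewrite /h; case: (_ \in _); rewrite ?powR1// powR0// invr_neq0// pnatr_eq0 -lt0n.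
have := @finner_inequality R 'I_d 'I_N 'I_d b window _ b0 window_cover h.
have -> : \sum_y \prod_i h i y `^ b%:R^-1 = (\sum_(y : Y) [forall k, vertex (s k) y \in A k])%:R.
  rewrite natr_sum; apply: eq_bigr => y _; under eq_bigr do rewrite -hroot.
  have [/forallP E|] := boolP [forall k, vertex (s k) y \in A k].
    rewrite big1// => i _; rewrite /h.
    by have := E ((s^-1)%g i); rewrite permKV => ->.
  rewrite negb_forall => /existsP[k kA].
  by rewrite (bigD1 (s k))//= /h permK (negbTE kA) mul0r.
rewrite card_Y => H.
rewrite -(ler_pM2l (x := ((N ^ d)%:R)^-1)); last first.
  by rewrite invr_gt0 ltr0n expn_gt0.
apply: (le_trans (H _ _ _)).
- by rewrite card_ord.
- by move=> i y; rewrite /h.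
- move=> i j ji y x; rewrite /h (_ : vertex i (update y j x) = vertex i y)//; congr pair.
  apply/eqP/mask_eqP => k ki; rewrite ffunE; case: eqVneq => // kj.
  by rewrite -kj ki in ji.
apply: (@le_trans _ _ (\prod_(i < d) (M%:R / (N ^ b)%:R) `^ (b%:R^-1))).
  apply: ler_prod => i _; rewrite powR_ge0/=.
  apply: ge0_ler_powR.
  - by rewrite invr_ge0.
  - by rewrite nnegrE; apply: mulr_ge0; [rewrite invr_ge0|apply: sumr_ge0].
  - by rewrite nnegrE; apply: mulr_ge0; rewrite ?invr_ge0.
  rewrite -natr_sum mulrC ler_pdivrMr ?ltr0n ?expn_gt0//.
  have Nd : (N ^ d = N ^ b * N ^ (d - b))%N by rewrite -expnD subnKC.
  rewrite Nd natrM mulrA divfK; last first.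
    by rewrite pnatr_eq0 expn_eq0.
  rewrite -natrM ler_nat mulnC; apply: (leq_trans (sum_vertex_in _ _)).
  by rewrite leq_mul2l; apply/orP; right; exact: leq_bigmax.
rewrite prodr_const card_ord -powR_mulrn ?powR_ge0// -powRrM.
have -> : (b%:R^-1 * d%:R : R) = d%:R / b%:R by rewrite mulrC.
rewrite powRM ?invr_ge0// mulrC.
have Nk k : ((N ^ k)%:R^-1 : R) = N%:R `^ (- k%:R).
  by rewrite powRN powR_mulrn// natrX.
rewrite !Nk -powRrM mulNr [b%:R * _]mulrC divfK// pnatr_eq0.
by rewrite -lt0n.
Qed.

(** The constant is the quotient of the [d`!] orderings of an edge by the effect
    of the [d] tags on the number of vertices. *)
Lemma size_bound :
  d`!%:R / d%:R `^ (d%:R / b%:R) * #|` vertices|%:R `^ (d%:R / b%:R)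
    = #|` edges|%:R :> R.
Proof.
have b0 : (0 < b)%N := ltnW b_gt1.
rewrite card_vertices card_edges !natrM powRM// mulrA divfK; last first.
  by rewrite gt_eqF// powR_gt0 ltr0n.
rewrite !natrX -!powR_mulrn// -powRrM [b%:R * _]mulrC divfK//.
by rewrite pnatr_eq0 -lt0n.
Qed.

End dimension.
End size.
End construction.

Local Open Scope classical_set_scope.
Local Open Scope ring_scope.

(** * Gaussian expectations as pairings *)

Section wick.
Context {R : realType} {K : eqType}.
Local Notation m := (@gaussian_moment R).

(** The expectation of the product, over the list [l], of independent standard
    normal variables indexed by [F]. *)
Definition pairing_weight (F l : seq K) : R :=
  \prod_(f <- F) m (count_mem f l).

Lemma prod_count (F l : seq K) (G : K -> R) : uniq F -> {subset l <= F} ->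
  \prod_(a <- l) G a = \prod_(f <- F) G f ^+ count_mem f l.
Proof.
move=> uF; elim: l => [|a l IH] lF.
  by rewrite big_nil big1// => f _; rewrite expr0.
rewrite big_cons IH; last by move=> x xl; apply: lF; rewrite inE xl orbT.
under [RHS]eq_bigr do rewrite /= exprD.
rewrite big_split/=; congr (_ * _).
rewrite (bigD1_seq a)//= ?lF ?mem_head// eqxx expr1 big1 ?mulr1//.
by move=> f; rewrite eq_sym => /negbTE ->; rewrite expr0.
Qed.

Lemma pairing_weightE (F l : seq K) : uniq F -> {subset l <= F} ->
  pairing_weight F l = \prod_(f <- undup l) m (count_mem f l).
Proof.
move=> uF lF; rewrite /pairing_weight (bigID (mem l))/= [X in _ * X]big1; last first.
  by move=> f /count_memPn ->; exact: gaussian_moment0.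
rewrite mulr1 -big_filter; apply: perm_big; apply: uniq_perm.
- exact: filter_uniq.
- exact: undup_uniq.
- by move=> f; rewrite mem_filter mem_undup andb_idr//; exact: lF.
Qed.

Lemma pairing_weight2 (F : seq K) a b : uniq F -> a \in F -> b \in F ->
  pairing_weight F [:: a; b] = (a == b)%:R.
Proof.
move=> uF aF bF; rewrite pairing_weightE//; last first.
  by move=> x; rewrite !inE => /orP[]/eqP->.
rewrite /= !inE; case: (eqVneq a b) => [->|ab].
  by rewrite big_seq1 eqxx gaussian_moment2.
by rewrite !big_cons big_nil eqxx (eq_sym b) (negbTE ab)/= gaussian_moment_odd ?mul0r.
Qed.

(** Odd moments vanish, so only multiplicities 2+2 and 4 survive; the
    fourth moment enters through an upper bound alone. *)
Lemma pairing_weight4 (F : seq K) a b c d : uniq F -> a \in F -> b \in F ->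
  c \in F -> d \in F ->
  let W := pairing_weight F [:: a; b; c; d] in
  [/\ 0 <= W <= Num.max 1 (m 4),
      W != 0 -> [\/ a = b /\ c = d, a = c /\ b = d | a = d /\ b = c] &
      a = b -> c = d -> a != c -> W = 1].
Proof.
move=> uF aF bF cF dF W.
have m1 : m 1 = 0 by exact: gaussian_moment_odd.
have m3 : m 3 = 0 by exact: gaussian_moment_odd.
have m2 : m 2 = 1 := gaussian_moment2.
have m4 : 0 <= m 4 := gaussian_moment4_ge0.
have b0 : 0 <= (0 : R) <= Num.max 1 (m 4) by rewrite lexx le_max ler01.
have b1 : 0 <= (1 : R) <= Num.max 1 (m 4) by rewrite ler01 le_max lexx.
have b4 : 0 <= m 4 <= Num.max 1 (m 4) by rewrite m4 le_max lexx orbT.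
rewrite /W pairing_weightE//; last first.
  by move=> x; rewrite !inE => /or4P[]/eqP->.
rewrite /= !inE.
have neq (x y : K) : x != y -> ((x == y = false) * (y == x = false))%type.
  by move=> /negbTE xy; split => //; rewrite eq_sym.
clear W aF bF cF dF.
case: (eqVneq a b) => [?|/neq ab]; try subst b;
  case: (eqVneq a c) => [?|/neq ac]; try subst c;
  case: (eqVneq a d) => [?|/neq ad]; try subst d;
  try (case: (eqVneq b c) => [?|/neq bc]; try subst c);
  try (case: (eqVneq b d) => [?|/neq bd]; try subst d);
  try (case: (eqVneq c d) => [?|/neq cd]; try subst d);
  repeat match goal with H : prod (_ = false) _ |- _ =>
    progress rewrite ?H end; rewrite ?eqxx ?orbT /= ?big_cons ?big_nil;
  repeat match goal with H : prod (_ = false) _ |- _ =>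
    progress rewrite ?H end;
  rewrite ?eqxx /= ?m1 ?m2 ?m3 ?mul0r ?mulr0 ?mulr1 ?eqxx; split => //;
  try (by move=> _; first [by constructor 1|by constructor 2|by constructor 3]);
  by move=> /eqP E1 /eqP E2 E3; move: E1 E2 E3;
    repeat match goal with H : prod (_ = false) _ |- _ =>
      progress rewrite ?H end; rewrite ?eqxx.
Qed.
End wick.

Local Close Scope classical_set_scope.

Section pairing_count.
Context {R : realType} (d' b N' : nat).
Local Notation d := d'.+1.
Local Notation N := N'.+1.
Hypothesis b_gt1 : (1 < b)%N.
Hypothesis b_le : (b <= d)%N.
Local Notation Y := {ffun 'I_d -> 'I_N}.
Local Notation quad := (('I_N * 'I_N) * ('I_N * 'I_N))%type.
Implicit Types (q : (Y * Y) * (Y * Y)).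

Definition column q (j : 'I_d) : quad :=
  ((q.1.1 j, q.1.2 j), (q.2.1 j, q.2.2 j)).

Definition paired : {set quad} :=
  [set x : quad | [|| (x.1.1 == x.1.2) && (x.2.1 == x.2.2),
     (x.1.1 == x.2.1) && (x.1.2 == x.2.2) | (x.1.1 == x.2.2) && (x.1.2 == x.2.1)]].

Definition collapsed : {set quad} :=
  [set x : quad | [&& x.1.1 == x.1.2, x.1.2 == x.2.1 & x.2.1 == x.2.2]].

Lemma card_paired : (#|paired| <= 3 * N ^ 2)%N.
Proof.
pose f1 (x : 'I_N * 'I_N) : quad := ((x.1, x.1), (x.2, x.2)).
pose f2 (x : 'I_N * 'I_N) : quad := ((x.1, x.2), (x.1, x.2)).
pose f3 (x : 'I_N * 'I_N) : quad := ((x.1, x.2), (x.2, x.1)).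
have img (f : 'I_N * 'I_N -> quad) : (#|f @: [set: 'I_N * 'I_N]| <= N ^ 2)%N.
  by rewrite (leq_trans (leq_imset_card _ _))// cardsT card_prod !card_ord.
have sub : paired \subset (f1 @: [set: 'I_N * 'I_N]) :|:
    (f2 @: [set: 'I_N * 'I_N]) :|: (f3 @: [set: 'I_N * 'I_N]).
  apply/fintype.subsetP => -[[x1 x2] [x3 x4]]; rewrite !inE/=.
  case/or3P => /andP[/eqP-> /eqP->].
  - by apply/orP; left; apply/orP; left; apply/imsetP; exists (x2, x4); rewrite ?inE.
  - by apply/orP; left; apply/orP; right; apply/imsetP; exists (x3, x4); rewrite ?inE.
  - by apply/orP; right; apply/imsetP; exists (x4, x3); rewrite ?inE.
apply: (leq_trans (subset_leq_card sub)).
have U (A B : {set quad}) : (#|A :|: B| <= #|A| + #|B|)%N.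
  by rewrite cardsU leq_subr.
apply: leq_trans (U _ _) _; apply: leq_trans (leq_add (U _ _) (leqnn _)) _.
apply: leq_trans (leq_add (leq_add (img f1) (img f2)) (img f3)) _.
by rewrite !mulSn mul0n addn0 addnA.
Qed.

Lemma card_collapsed : (#|collapsed| <= N)%N.
Proof.
pose f (x : 'I_N) : quad := ((x, x), (x, x)).
have sub : collapsed \subset f @: [set: 'I_N].
  apply/fintype.subsetP => -[[x1 x2] [x3 x4]]; rewrite !inE/=.
  by case/and3P => /eqP-> /eqP-> /eqP->; apply/imsetP; exists x4; rewrite ?inE.
by rewrite (leq_trans (subset_leq_card sub))// (leq_trans (leq_imset_card _ _))// cardsT card_ord.
Qed.

Definition all_paired q := [forall j, column q j \in paired].
Definition some_collapsed q := [exists j, column q j \in collapsed].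

(** Each coordinate of such a configuration is one of at most [3 * N ^ 2]
    quadruples, and one coordinate is one of only [N]. *)
Lemma card_degenerate :
  (\sum_q (all_paired q && some_collapsed q) <= d * (N * (3 * N ^ 2) ^ d'))%N.
Proof.
apply: (@leq_trans (\sum_q \sum_(j0 < d) (all_paired q && (column q j0 \in collapsed)))%N).
  apply: leq_sum => q _; case: andP => // -[qp /existsP[j0 qj]].
  by rewrite (bigD1 j0)//= qp qj.
rewrite exchange_big/= -[X in (_ <= X * _)%N]card_ord -sum_nat_const.
apply: leq_sum => j0 _.
pose B j := if j == j0 then collapsed else paired.
pose g q := [ffun j => column q j].
have g_inj : injective g.
  move=> [[y0 y1] [y2 y3]] [[z0 z1] [z2 z3]] /ffunP E.
  have E' j := E j.
  by congr (_, _, (_, _)); apply/ffunP => j; have := E' j; rewrite !ffunE => -[].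
have -> : (\sum_q (all_paired q && (column q j0 \in collapsed)) =
    #|[set q | all_paired q && (column q j0 \in collapsed)]|)%N.
  rewrite -sum1_card [RHS]big_mkcond; apply: eq_bigr => q _; rewrite inE.
  by case: (_ && _).
rewrite -(card_imset _ g_inj).
apply: (@leq_trans #|[set f : {ffun 'I_d -> quad} | [forall j, f j \in B j]]|).
  apply/subset_leq_card/fintype.subsetP => f /imsetP[q]; rewrite inE => /andP[/forallP qp qj] ->.
  rewrite inE; apply/forallP => j; rewrite ffunE /B.
  by case: eqVneq => [->|_]; [exact: qj|exact: qp].
rewrite card_ffun_in (bigD1 j0)//= /B eqxx leq_mul ?card_collapsed//.
apply: (@leq_trans (\prod_(i < d | i != j0) (3 * N ^ 2))%N).
  by apply: leq_prod => j /negbTE ->; exact: card_paired.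
by rewrite prod_nat_const cardC1 card_ord.
Qed.

Local Notation Ki := (Num.max 1 (gaussian_moment 4 : R)).

(** The contribution of four functions to the second moment of the conditional
    variance: window [0] imposes the pairing of the squares, the other windows
    contribute Gaussian expectations. *)
Definition weight q : R :=
  (mask b ord0 q.1.1 == mask b ord0 q.1.2)%:R * (mask b ord0 q.2.1 == mask b ord0 q.2.2)%:R *
  \prod_(i < d | i != ord0) pairing_weight (masks b N' i)
    [seq mask b i y | y <- [:: q.1.1; q.1.2; q.2.1; q.2.2]].

(** If no coordinate is collapsed, two different pairings cannot hold at one
    coordinate.  Consecutive windows share a coordinate, so the pairing of
    window [0] propagates to all windows. *)
Lemma weight_le q : weight q <=
  ((q.1.1 == q.1.2) && (q.2.1 == q.2.2))%:R +
  Ki ^+ d * (all_paired q && some_collapsed q)%:R.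
Proof.
case: q => -[y0 y1] [y2 y3] /=.
have K1 : 1 <= Ki by rewrite le_max lexx.
have rhs0 : 0 <= ((y0 == y1) && (y2 == y3))%:R +
    Ki ^+ d * (all_paired (y0, y1, (y2, y3)) && some_collapsed (y0, y1, (y2, y3)))%:R.
  by rewrite addr_ge0 ?mulr_ge0 ?exprn_ge0 ?ler0n// (le_trans ler01).
rewrite /weight/=; have [m01|] := boolP (_ == _); last by rewrite !mul0r.
have [m23|] := boolP (_ == _); last by rewrite mulr0 mul0r.
rewrite !mul1r.
pose W i := pairing_weight (R := R) (masks b N' i)
  [:: mask b i y0; mask b i y1; mask b i y2; mask b i y3].
rewrite -/(W _).
have Wp i := pairing_weight4 (R := R) (undup_uniq _) (mem_masks b i y0) (mem_masks b i y1)
  (mem_masks b i y2) (mem_masks b i y3).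
have [/eqP ->//|Wn0] := boolP (\prod_(i < d | i != ord0) W i == 0).
have {}Wn0 i : i != ord0 -> W i != 0.
  by move=> i0; apply: contraNneq Wn0 => Wi; rewrite (bigD1 i)//= Wi mul0r.
have pairs i : [\/ mask b i y0 = mask b i y1 /\ mask b i y2 = mask b i y3,
    mask b i y0 = mask b i y2 /\ mask b i y1 = mask b i y3 |
    mask b i y0 = mask b i y3 /\ mask b i y1 = mask b i y2].
  have [->|i0] := eqVneq i ord0; first by constructor 1; split; exact/eqP.
  by have [_ + _] := Wp i; apply; exact: Wn0.
have ap : all_paired (y0, y1, (y2, y3)).
  apply/forallP => j; rewrite inE /column/=.
  have js := window_self b_gt1 j.
  case: (pairs j) => -[/eqP/mask_eqP/(_ j js) -> /eqP/mask_eqP/(_ j js) ->];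
   by rewrite !eqxx ?orbT.
have [bad|good] := boolP (some_collapsed (y0, y1, (y2, y3))).
  rewrite ap/= mulr1 ler_wpDl// ?ler0n//.
  apply: (@le_trans _ _ (\prod_(i < d | i != ord0) Ki)).
    by apply: ler_prod => i _; have [] := Wp i.
  rewrite prodr_const; apply: ler_weXn2l => //.
  by rewrite cardC1 card_ord.
rewrite ap/= mulr0 addr0.
have first_pairing i : mask b i y0 = mask b i y1 /\ mask b i y2 = mask b i y3.
  case: i => i; elim: i => [|i IH] hi.
    have -> : Ordinal hi = ord0 by exact: val_inj.
    by split; exact/eqP.
  have hi' : (i < d)%N := ltnW hi.
  have [/eqP/mask_eqP e1 /eqP/mask_eqP e2] := IH hi'.
  have := window_next b_gt1 (i := Ordinal hi') hi.
  rewrite inE => /andP[w1 w2].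
  move/existsPn : good => /(_ (Ordinal hi)); rewrite inE /column/=.
  rewrite (e1 _ w1) (e2 _ w1) !eqxx/= andbT => good.
  case: (pairs (Ordinal hi)) => // -[/eqP/mask_eqP/(_ _ w2) e3 /eqP/mask_eqP/(_ _ w2) e4].
    by rewrite e4 eqxx in good.
  by rewrite e4 (e2 _ w1) eqxx in good.
have y01 : y0 = y1.
  apply/ffunP => j; have [/eqP/mask_eqP + _] := first_pairing j.
  by apply; exact: window_self.
have y23 : y2 = y3.
  apply/ffunP => j; have [_ /eqP/mask_eqP +] := first_pairing j.
  by apply; exact: window_self.
have -> : (y0 == y1) && (y2 == y3) by rewrite y01 y23 !eqxx.
rewrite big1// => i i0; have [_ _ Wone] := Wp i; apply: Wone.
- by rewrite y01.
- by rewrite y23.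
- apply/negP => /mask_eqP E; move/existsPn : good => /(_ i) /negP; apply.
  by rewrite inE /column/= y01 y23 !eqxx/= andbT -y01 -y23 E ?window_self.
Qed.

Lemma sum_diagonal : (\sum_(p : Y * Y) (p.1 == p.2) = N ^ d)%N.
Proof.
rewrite -(pair_bigA _ (fun y z : Y => (y == z) : nat))/= -card_Y -sum1_card.
apply: eq_bigr => y _; rewrite (bigD1 y)//= eqxx big1// => z.
by rewrite eq_sym => /negbTE ->.
Qed.

Lemma sum_weight : \sum_q weight q <=
  N%:R ^+ (2 * d) + Ki ^+ d * (d%:R * (3 ^+ d' * N%:R ^+ (2 * d').+1)).
Proof.
apply: (le_trans (ler_sum _ (fun q _ => weight_le q))).
rewrite big_split/= lerD//.
  rewrite -natr_sum -natrX ler_nat.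
  rewrite -(pair_bigA _ (fun p r : Y * Y => (p.1 == p.2) && (r.1 == r.2) : nat))/=.
  rewrite (eq_bigr (fun p : Y * Y => (p.1 == p.2) * (N ^ d)))%N; last first.
    move=> p _; rewrite -sum_diagonal big_distrr/=; apply: eq_bigr => r _.
    by rewrite mulnb.
  by rewrite -big_distrl/= sum_diagonal -expnD addnn mul2n.
rewrite -mulr_sumr ler_wpM2l ?exprn_ge0 ?(le_trans ler01) ?le_max ?lexx//.
rewrite -natr_sum -!natrX -!natrM ler_nat.
apply: (leq_trans card_degenerate); rewrite leq_mul2l; apply/orP; right.
by rewrite expnMn -expnM mulnCA expnS.
Qed.

End pairing_count.

Local Open Scope classical_set_scope.
Local Open Scope ring_scope.

(** * Concentration of the conditional variance *)

Section linear.
Context {R : realType} {disp : measure_display} {Omega : measurableType disp}.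
Context (P : probability Omega R).

(** Keeping integrability next to the value makes linearity of the expectation
    compositional. *)
Definition has_mean (F : Omega -> R) (v : R) : Prop :=
  P.-integrable setT (fun w => (F w)%:E) /\ (\int[P]_w (F w)%:E = v%:E)%E.

Lemma has_mean_cst c : has_mean (fun=> c) c.
Proof.
split; first exact: finite_measure_integrable_cst.
by rewrite integral_cst//= probability_setT mule1.
Qed.

Lemma has_meanD F G v u : has_mean F v -> has_mean G u ->
  has_mean (fun w => F w + G w) (v + u).
Proof.
move=> [iF EF] [iG EG]; split; first exact: (integrableD measurableT iF iG).
under eq_integral do rewrite EFinD.
by rewrite integralD// EF EG.
Qed.

Lemma has_meanZ F v c : has_mean F v -> has_mean (fun w => c * F w) (c * v).
Proof.
move=> [iF EF]; split; first exact: (integrableZl measurableT c iF).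
under eq_integral do rewrite EFinM.
by rewrite integralZl// EF.
Qed.

Lemma has_mean_sum (K : Type) (s : seq K) (F : K -> Omega -> R) (v : K -> R) :
  (forall k, has_mean (F k) (v k)) ->
  has_mean (fun w => \sum_(k <- s) F k w) (\sum_(k <- s) v k).
Proof.
move=> H; elim: s => [|k s IH].
  have := has_mean_cst 0; rewrite big_nil.
  by congr has_mean; apply/funext => w; rewrite big_nil.
rewrite big_cons; have := has_meanD (H k) IH.
by congr has_mean; apply/funext => w; rewrite big_cons.
Qed.

Lemma has_mean_le F G v u : (forall w, F w <= G w) ->
  has_mean F v -> has_mean G u -> v <= u.
Proof.
move=> FG [iF EF] [iG EG]; rewrite -lee_fin -EF -EG.
by apply: le_integral => // w _; rewrite lee_fin.
Qed.

Lemma has_mean_ext F G v u : F =1 G -> v = u -> has_mean F v -> has_mean G u.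
Proof. by move=> /funext -> ->. Qed.

End linear.

Section variance.
Variables (d' b N' : nat).
Local Notation d := d'.+1.
Local Notation N := N'.+1.
Hypothesis b_gt1 : (1 < b)%N.
Hypothesis b_le : (b <= d)%N.
Local Notation Y := {ffun 'I_d -> 'I_N}.
Local Notation T := (vertex_type d').
Context {R : realType} {disp : measure_display} {Omega : measurableType disp}.
Context (P : probability Omega R) (D : set T) (X : T -> {RV P >-> R}).
Hypothesis iid : iid_standard_normal D X.
Hypothesis D_vertex : forall (i : 'I_d) (y : Y), D (vertex b i y).

Definition tail_monomial (ys : seq Y) (w : Omega) : R :=
  \prod_(y <- ys) \prod_(i < d | i != ord0) X (vertex b i y) w.

Definition tail_vertices : seq T :=
  [seq (i, f) | i <- [seq i <- enum 'I_d | i != ord0], f <- masks b N' i].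

Lemma tail_vertices_uniq : uniq tail_vertices.
Proof.
apply: allpairs_uniq_dep.
- by rewrite filter_uniq ?enum_uniq.
- by move=> i _; exact: undup_uniq.
- by move=> [i f] [j g] _ _ /= [-> ->].
Qed.

Lemma tail_verticesD v : v \in tail_vertices -> D v.
Proof. by move=> /allpairsPdep[i [f [_ /mem_masksP[y ->] ->]]]; exact: D_vertex. Qed.

Lemma has_mean_tail_monomial (ys : seq Y) :
  has_mean P (tail_monomial ys)
    (\prod_(i < d | i != ord0)
      pairing_weight (masks b N' i) [seq mask b i y | y <- ys]).
Proof.
pose k (v : T) := count_mem v.2 [seq mask b v.1 y | y <- ys].
have [iE EE] := expectation_monomial iid k tail_vertices_uniq tail_verticesD.
apply: (has_mean_ext _ _ (conj iE EE)).
  move=> w; rewrite big_allpairs_dep/= big_filter big_enum_cond/=.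
  rewrite /tail_monomial exchange_big/=; apply: eq_bigr => i _.
  rewrite /k/= -(prod_count (fun f => X (i, f) w))//.
  - by rewrite big_map.
  - exact: undup_uniq.
  - by move=> f /mapP[y _ ->]; exact: mem_masks.
by rewrite big_allpairs_dep/= big_filter big_enum_cond/=.
Qed.

Let c : R := (Num.sqrt (N ^ d)%:R)^-1.

Let c2 : c ^+ 2 = ((N ^ d)%:R)^-1.
Proof. by rewrite exprVn sqr_sqrtr. Qed.

(** The coefficient of the variable of the vertex [(ord0, f)] in the normalized
    sum. *)
Definition coefficient (f : {ffun 'I_d -> nat}) (w : Omega) : R :=
  c * \sum_(y : Y | mask b ord0 y == f) tail_monomial [:: y] w.

Definition conditional_variance (w : Omega) : R :=
  \sum_(f <- masks b N' ord0) coefficient f w ^+ 2.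

Lemma tail_monomial_cat ys zs w :
  tail_monomial (ys ++ zs) w = tail_monomial ys w * tail_monomial zs w.
Proof. by rewrite /tail_monomial big_cat. Qed.

Lemma conditional_varianceE w : conditional_variance w =
  \sum_(p : Y * Y) ((N ^ d)%:R^-1 * (mask b ord0 p.1 == mask b ord0 p.2)%:R) *
    tail_monomial [:: p.1; p.2] w.
Proof.
have E f : coefficient f w ^+ 2 = \sum_(p : Y * Y)
    ((N ^ d)%:R^-1 * ((mask b ord0 p.1 == f)%:R * (mask b ord0 p.2 == f)%:R)) *
    tail_monomial [:: p.1; p.2] w.
  rewrite /coefficient exprMn c2 expr2 big_distrlr/= mulr_sumr.
  rewrite -(pair_bigA _ (fun y z : Y =>
    ((N ^ d)%:R^-1 * ((mask b ord0 y == f)%:R * (mask b ord0 z == f)%:R)) *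
    tail_monomial [:: y; z] w))/=.
  rewrite big_mkcond; apply: eq_bigr => y _; case: eqP => [_|_]; last first.
    by rewrite big1// => z _; rewrite mul0r mulr0 mul0r.
  rewrite mulr_sumr big_mkcond; apply: eq_bigr => z _; case: eqP => [_|_]; last first.
    by rewrite mulr0 mulr0 mul0r.
  by rewrite !mulr1 (tail_monomial_cat [:: y] [:: z]).
rewrite /conditional_variance (eq_bigr _ (fun f _ => E f)) exchange_big/=.
apply: eq_bigr => p _; rewrite -mulr_suml -mulr_sumr; congr (_ * _ * _).
rewrite (bigD1_seq (mask b ord0 p.1))/= ?mem_masks ?undup_uniq// eqxx mul1r eq_sym.
rewrite big1 ?addr0// => f; rewrite eq_sym => /negbTE ->.
by rewrite mul0r.
Qed.

(** Two functions contribute only if they agree on every window, hence are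
    equal. *)
Lemma has_mean_conditional_variance : has_mean P conditional_variance 1.
Proof.
have H (p : Y * Y) := has_meanZ ((N ^ d)%:R^-1 * (mask b ord0 p.1 == mask b ord0 p.2)%:R)
  (has_mean_tail_monomial [:: p.1; p.2]).
apply: (has_mean_ext _ _ (has_mean_sum (index_enum _) H)).
  by move=> w; rewrite conditional_varianceE.
rewrite (eq_bigr (fun p : Y * Y => (N ^ d)%:R^-1 * (p.1 == p.2)%:R)); last first.
  move=> p _; rewrite -mulrA; congr (_ * _).
  rewrite (eq_bigr (fun i => (mask b i p.1 == mask b i p.2)%:R)); last first.
    by move=> i _; rewrite /= pairing_weight2 ?undup_uniq ?mem_masks.
  have [->|ne] := eqVneq p.1 p.2.
    by rewrite eqxx mul1r big1// => i _; rewrite eqxx.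
  have [j pj] : exists j, p.1 j != p.2 j.
    apply/existsP; rewrite -negb_forall; apply: contraNN ne => /forallP E.
    by apply/eqP/ffunP => j; apply/eqP.
  have mj : (mask b j p.1 == mask b j p.2) = false.
    apply/negP => /mask_eqP /(_ j (window_self b_gt1 j)) E.
    by rewrite E eqxx in pj.
  have [j0|j0] := eqVneq j ord0; first by rewrite -j0 mj mul0r.
  by rewrite (bigD1 j)//= mj mul0r mulr0.
by rewrite -mulr_sumr -natr_sum sum_diagonal mulVf// pnatr_eq0 expn_eq0.
Qed.

(** The weight of four functions is at most the first factor; the second one
    comes from [card_degenerate]. *)
Definition deviation_constant : R :=
  Num.max 1 (gaussian_moment 4) ^+ d * (d%:R * 3 ^+ d').

Lemma has_mean_deviation : exists2 v : R,
  has_mean P (fun w => (conditional_variance w - 1) ^+ 2) v &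
  v <= deviation_constant / N%:R.
Proof.
have H (q : (Y * Y) * (Y * Y)) := has_meanZ
  ((N ^ d)%:R^-1 ^+ 2 * ((mask b ord0 q.1.1 == mask b ord0 q.1.2)%:R
                    * (mask b ord0 q.2.1 == mask b ord0 q.2.2)%:R))
  (has_mean_tail_monomial [:: q.1.1; q.1.2; q.2.1; q.2.2]).
have H4 : has_mean P (fun w => conditional_variance w ^+ 2)
    ((N ^ d)%:R^-1 ^+ 2 * \sum_(q : (Y * Y) * (Y * Y)) weight b q).
  apply: (has_mean_ext _ _ (has_mean_sum (index_enum _) H)).
    move=> w; rewrite conditional_varianceE [RHS]expr2 big_distrlr/= pair_bigA/=.
    apply: eq_bigr => q _.
    rewrite (tail_monomial_cat [:: q.1.1; q.1.2] [:: q.2.1; q.2.2]); ring.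
  by rewrite mulr_sumr; apply: eq_bigr => q _; rewrite /weight !mulrA.
exists ((N ^ d)%:R^-1 ^+ 2 * \sum_(q : (Y * Y) * (Y * Y)) weight b q + (- 2 * 1 + 1)).
  apply: (has_mean_ext _ _ (has_meanD H4 (has_meanD
    (has_meanZ (- 2) has_mean_conditional_variance) (has_mean_cst P 1)))) => // w.
  ring.
have Nd0 : 0 < ((N ^ d)%:R : R) by rewrite ltr0n expn_gt0.
have := @sum_weight R d' b N' b_gt1.
rewrite -(ler_pM2l (x := (N ^ d)%:R^-1 ^+ 2)) ?exprn_gt0 ?invr_gt0// => h.
apply: (@le_trans _ _ (((N ^ d)%:R^-1 ^+ 2 * (N%:R ^+ (2 * d) +
    Num.max 1 (gaussian_moment 4) ^+ d * (d%:R * (3 ^+ d' * N%:R ^+ (2 * d').+1)))) +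
    (- 2 * 1 + 1))).
  by rewrite lerD2r.
rewrite le_eqVlt; apply/orP; left; apply/eqP; rewrite /deviation_constant.
have -> : (2 * d = (2 * d').+1.+1)%N by rewrite mulnS.
rewrite natrX exprVn -exprM mulnC.
have -> : (2 * d = (2 * d').+1.+1)%N by rewrite mulnS.
rewrite exprS.
have N0 : (N%:R : R) != 0 by rewrite pnatr_eq0.
field.
by rewrite expf_neq0// nat1r N0.
Qed.

Definition head_sum (w : Omega) : R :=
  \sum_(v <- [seq (ord0, f) | f <- masks b N' ord0]) coefficient v.2 w * X v w.

Lemma head_sumE w : head_sum w =
  c * \sum_(y : Y) \prod_(i < d) X (vertex b i y) w.
Proof.
rewrite /head_sum big_map /coefficient/= mulr_sumr.
rewrite (eq_bigr (fun f => \sum_(y : Y) ((mask b ord0 y == f)%:R *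
   (c * tail_monomial [:: y] w * X (ord0, mask b ord0 y) w)))); last first.
  move=> f _; rewrite big_distrr/= big_distrl/= big_mkcond; apply: eq_bigr => y _.
  by case: eqP => [->|_]; rewrite ?mul1r ?mul0r.
rewrite exchange_big/=; apply: eq_bigr => y _.
rewrite (bigD1_seq (mask b ord0 y))/= ?mem_masks ?undup_uniq// eqxx mul1r big1.
  rewrite addr0 -mulrA [in RHS](bigD1 ord0)//= [X in _ * X]mulrC.
  by rewrite /tail_monomial big_seq1.
by move=> f; rewrite eq_sym => /negbTE ->; rewrite mul0r.
Qed.

Lemma head_sum_law (r : R) :
  P [set w | head_sum w <= r] =
  (\int[P]_w gaussian_cdf (Num.sqrt (conditional_variance w)) r)%E.
Proof.
pose J := [fset v in tail_vertices]%fset.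
have ma f : measurable_fun setT (coefficient f : sub_space X J -> R).
  apply: measurable_funM => //; rewrite /tail_monomial.
  under eq_fun do rewrite -big_filter.
  apply: measurable_sum => y.
  under eq_fun do rewrite big_seq1 -big_filter.
  apply: measurable_prod => i; rewrite mem_filter => /andP[i0 _].
  apply: measurable_coordinate; rewrite inE; apply/allpairsPdep.
  by exists i, (mask b i y); rewrite mem_filter i0 mem_enum mem_masks.
have := @gaussian_mixture R disp Omega P T D X iid
  [seq (ord0, f) | f <- masks b N' ord0] J (fun v => coefficient v.2) (fun=> r).
move=> ->.
- by apply: eq_integral => w _; rewrite /conditional_variance big_map.
- by rewrite map_inj_uniq ?undup_uniq// => f g [].
- by move=> v /=; rewrite inE => /tail_verticesD.
- move=> v /mapP[f /mem_masksP[y ->] ->]; split; first exact: D_vertex.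
  rewrite inE; apply/allpairsPdep => -[i [g [+ _ [i0 _]]]].
  by rewrite mem_filter -i0 eqxx.
- by move=> v; exact: ma.
- exact: measurable_cst.
Qed.

Lemma conditional_variance_ge0 w : 0 <= conditional_variance w.
Proof. by apply: sumr_ge0 => f _; exact: sqr_ge0. Qed.

(** The mean of [|x|] is bounded through [|x| <= delta + x ^+ 2 / delta]. *)
Lemma head_sum_cdf (r C delta : R) : 0 < delta -> 0 <= C ->
  (forall s, 0 <= s -> `| fine (gaussian_cdf s r) - fine (normal_prob (0 : R) 1 `]-oo, r]) |
     <= C * `|s ^+ 2 - 1|) ->
  `| fine (P [set w | head_sum w <= r]) - fine (normal_prob (0 : R) 1 `]-oo, r]) |
    <= C * (delta + deviation_constant / N%:R / delta).
Proof.
move=> delta0 C0 lip; rewrite head_sum_law.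
set Phi := fine (normal_prob _ _ _).
pose g w := fine (gaussian_cdf (Num.sqrt (conditional_variance w)) r).
have [v [iV EV] vle] := has_mean_deviation.
have mV : measurable_fun setT conditional_variance.
  have [iV1 _] := has_mean_conditional_variance.
  by case/integrableP : iV1 => /measurable_EFinP.
have mg : measurable_fun setT g.
  pose h w : R * R := (Num.sqrt (conditional_variance w), r).
  have mh : measurable_fun setT h.
    apply: measurable_fun_pair => //; apply: measurableT_comp mV.
    by apply: continuous_measurable_fun; exact: sqrt_continuous.
  apply/measurable_EFinP; have := measurableT_comp measurable_gaussian_cdf mh.
  congr measurable_fun; apply/funext => w /=.
  by rewrite fineK// gaussian_cdf_fin_num.
have bound w : `|g w - Phi| <=
    C * delta + C / delta * (conditional_variance w - 1) ^+ 2.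
  apply: (le_trans (lip _ (sqrtr_ge0 _))).
  rewrite sqr_sqrtr ?conditional_variance_ge0// -mulrA -mulrDr ler_wpM2l//.
  set x := conditional_variance w - 1; rewrite [_ * x ^+ 2]mulrC.
  have [xd|dx] := leP `|x| delta.
    by rewrite (le_trans xd)// lerDl mulr_ge0 ?sqr_ge0// invr_ge0 ltW.
  rewrite ler_wpDl ?(ltW delta0)// ler_pdivlMr//.
  by rewrite -[x ^+ 2]real_normK ?num_real// expr2 ler_wpM2l// ltW.
have ug : has_mean P g (fine (\int[P]_w (g w)%:E)%E).
  have ig : P.-integrable setT (EFin \o g).
    apply: (le_integrable measurableT _ _ (has_mean_cst P 1).1).
      exact/measurable_EFinP.
    move=> w _; rewrite lee_fin normr1.
    by have /andP[g0 g1] := fine_gaussian_cdf (Num.sqrt (conditional_variance w)) r;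
      rewrite ger0_norm.
  by split => //; rewrite fineK//; exact: integrable_fin_num.
set u := fine _ in ug.
have -> : (\int[P]_w gaussian_cdf (Num.sqrt (conditional_variance w)) r)%E = u%:E.
  by rewrite -ug.2; apply: eq_integral => w _; rewrite fineK// gaussian_cdf_fin_num.
have ub := has_meanD (has_mean_cst P (C * delta)) (has_meanZ (C / delta) (conj iV EV)).
have up := has_meanD ug (has_mean_cst P (- Phi)).
have un := has_meanD (has_mean_cst P Phi) (has_meanZ (-1) ug).
apply: (@le_trans _ _ (C * delta + C / delta * v)).
  rewrite ler_norml /=; apply/andP; split.
    rewrite lerNl opprB; have := has_mean_le _ un ub; rewrite mulN1r; apply.
    by move=> w; have := bound w; rewrite distrC mulN1r ler_norml => /andP[].
  have := has_mean_le _ up ub; apply.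
  by move=> w; have := bound w; rewrite ler_norml => /andP[].
rewrite mulrDr lerD2l -mulrA ler_wpM2l// mulrC ler_wpM2r// invr_ge0 ltW//.
Qed.

End variance.

(** * Dimension and central limit theorem for the fractional products *)

Section fractional_clt.
Variables (d' b : nat).
Local Notation d := d'.+1.
Hypothesis b_gt1 : (1 < b)%N.
Hypothesis b_le : (b <= d)%N.
Local Notation T := (vertex_type d').
Context {R : realType}.

Lemma edges_dimension : (b < d)%N ->
  combinatorial_dimension (fun n => vertices d' b n) (fun n => edges d' b n)
    (d%:R / b%:R : R).
Proof.
move=> bd; have b0 : 0 < (b%:R : R) by rewrite ltr0n ltnW.
have d1 : 1 <= (d%:R : R) by rewrite ler1n.
split.
  rewrite divr_gt0//= ler_pdivrMr// ler_peMr// ?ler1n//.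
  exact: ltnW.
exists (d`!%:R / d%:R `^ (d%:R / b%:R)), d`!%:R; split.
  rewrite divr_gt0 ?ltr0n ?fact_gt0// ?powR_gt0// ?ltr0n//=.
  rewrite ler_pdivrMr ?powR_gt0 ?ltr0n// ler_peMr//.
  have {1}-> : (1 : R) = 1 `^ (d%:R / b%:R) by rewrite powR1.
  by apply: ge0_ler_powR; rewrite ?nnegrE ?divr_ge0 ?(ltW b0).
near=> n; split; last by rewrite size_bound// lexx.
by move=> A _; exact: box_bound.
Unshelve. all: by end_near. Qed.

Context {disp : measure_display} {Omega : measurableType disp}.
Context (P : probability Omega R) (X : T -> {RV P >-> R}).

Lemma homogeneous_sumE (E : {fset d.-tuple T}) w :
  (homogeneous_sum X E : Omega -> R) w =
  \sum_(t <- E) \prod_(i < d) X (tnth t i) w.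
Proof.
rewrite /homogeneous_sum.
rewrite (big_morph (fun f : {mfun Omega >-> R} => (f : Omega -> R) w)
  (id1 := 0) (op1 := +%R))//.
apply: eq_bigr => t _.
by rewrite (big_morph (fun f : {mfun Omega >-> R} => (f : Omega -> R) w)
  (id1 := 1) (op1 := *%R)).
Qed.

(** The [d`!] orderings of an edge give the same product, and the two factors
    [d`!] under the square root cancel them. *)
Lemma homogeneous_sum_edges n w :
  (Num.sqrt (d`! * #|` edges d' b n|%fset)%N%:R)^-1 *
    (homogeneous_sum X (edges d' b n) : Omega -> R) w =
  head_sum b n X w.
Proof.
rewrite homogeneous_sumE head_sumE (perm_big _ (perm_edges d' b_gt1 n))/=.
rewrite big_map big_enum/= card_edges//.
rewrite -(pair_bigA _ (fun (s : 'S_d) (y : {ffun 'I_d -> 'I_n.+1}) =>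
  \prod_(i < d) X (tnth (edge b (s, y)) i) w))/=.
rewrite (eq_bigr (fun s : 'S_d => \sum_(y : {ffun 'I_d -> 'I_n.+1})
   \prod_(i < d) X (vertex b i y) w)); last first.
  move=> s _; apply: eq_bigr => y _.
  rewrite [RHS](reindex_inj (@perm_inj _ s))/=.
  by apply: eq_bigr => i _; rewrite tnth_mktuple.
rewrite sumr_const card_Sn; set total := \sum_y _.
rewrite -[total *+ _]mulr_natl mulrA; congr (_ * _).
have f0 : (d`!%:R : R) != 0 by rewrite pnatr_eq0 -lt0n fact_gt0.
rewrite mulnA natrM natrM sqrtrM ?mulr_ge0// -expr2 sqrtr_sqr ger0_norm//.
by rewrite invfM mulrAC mulVf// mul1r.
Qed.

Hypothesis iid : iid_standard_normal
  (\bigcup_n [set` vertices d' b n]) X.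

Lemma edges_clt : cvg_in_distribution (P := P)
  (fun n => (Num.sqrt (d`! * #|` edges d' b n|%fset)%N%:R)^-1 \o*
              homogeneous_sum X (edges d' b n))
  (normal_prob (0 : R) 1).
Proof.
move=> r _.
have [C C0 lip] := gaussian_cdf_lipschitz r.
have cdfE n : cdf (P := P) ((Num.sqrt (d`! * #|` edges d' b n|%fset)%N%:R)^-1 \o*
              homogeneous_sum X (edges d' b n)) r = P [set w | head_sum b n X w <= r].
  rewrite /cdf /distribution/= /pushforward; congr (P _).
  apply/seteqP; split => w /=; rewrite in_itv/= -homogeneous_sum_edges mulrC//.
under eq_fun do rewrite cdfE.
have Phi_fin : normal_prob (0 : R) 1 `]-oo, r] \is a fin_num by exact: fin_num_measure.
have head_fin n : P [set w | head_sum b n X w <= r] \is a fin_num.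
  by rewrite -cdfE fin_num_measure.
suff : P [set w | head_sum b n X w <= r] @[n --> \oo] -->
    (fine (normal_prob (0 : R) 1 `]-oo, r]))%:E.
  by rewrite fineK.
apply: cvg_EFin; first by near=> n.
apply/cvgrPdist_le => eps eps0.
pose K : R := deviation_constant d'.
have K0 : 0 <= K.
  by rewrite /K /deviation_constant !mulr_ge0 ?exprn_ge0 ?le_max ?ler01.
pose delta : R := eps / (2 * (C + 1)).
have delta0 : 0 < delta by rewrite divr_gt0// mulr_gt0//; lra.
near=> n.
have D_vertex (i : 'I_d) (y : {ffun 'I_d -> 'I_n.+1}) :
    (\bigcup_n [set` vertices d' b n]) (vertex b i y).
  by exists n => //=; exact: mem_vertex.
rewrite distrC /=.
apply: (le_trans (head_sum_cdf b_gt1 iid D_vertex delta0 C0 lip)).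
have h1 : C * delta <= eps / 2.
  rewrite /delta mulrA ler_pdivrMr; last by rewrite mulr_gt0//; lra.
  nra.
have h2 : C * (K / n.+1%:R / delta) <= eps / 2.
  have N0 : 0 < (n.+1%:R : R) by rewrite ltr0n.
  have big : C * K / delta / (eps / 2) <= n.+1%:R.
    apply: (@le_trans _ _ n%:R); last by rewrite ler_nat.
    by near: n; exact: nbhs_infty_ger.
  rewrite ler_pdivrMr in big; last by rewrite divr_gt0.
  have -> : C * (K / n.+1%:R / delta) = C * K / delta / n.+1%:R by ring.
  by rewrite ler_pdivrMr// [leRHS]mulrC.
by rewrite mulrDr [leRHS](splitr eps) lerD.
Unshelve. all: by end_near. Qed.

End fractional_clt.

Theorem theorem2p11 (R : realType) :
  (forall (d : nat) (T : choiceType) (V : nat -> {fset T})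
      (E : nat -> {fset d.-tuple T}) (alpha : R),
    (2 <= d)%N ->
    (forall n, V n != fset0) ->
    (fun n => #|` V n|%fset) @ \oo --> \oo ->
    (forall n, in_power (V n) (E n)) ->
    (forall n, symmetric_set (E n)) ->
    (forall n, non_diagonal (E n)) ->
    (fun n => #|` E n|%fset) @ \oo --> \oo ->
    combinatorial_dimension V E alpha ->
    1 < alpha <= d%:R ->
    irreducible R V E)
  /\
  (forall d b : nat, (3 <= d)%N -> (2 <= b <= d.-1)%N ->
    1 < (d%:R / b%:R : R) < d%:R /\
    exists (T : choiceType) (V : nat -> {fset T})
        (E : nat -> {fset d.-tuple T}),
      (forall n, V n != fset0) /\
      ((fun n => #|` V n|%fset) @ \oo --> \oo) /\
      (forall n, in_power (V n) (E n)) /\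
      (forall n, symmetric_set (E n)) /\
      (forall n, non_diagonal (E n)) /\
      ((fun n => #|` E n|%fset) @ \oo --> \oo) /\
      combinatorial_dimension V E (d%:R / b%:R : R) /\
      (forall (disp : measure_display) (Omega : measurableType disp)
          (P : probability Omega R) (X : T -> {RV P >-> R}),
        iid_standard_normal (\bigcup_n [set` V n]) X ->
        irreducible_CLT X V E)).
Proof.
split.
  move=> d T V E alpha _ _ _ _ _ _ Ey dimE /andP[a1 _].
  exact: superlinear_irreducible Ey dimE a1.
move=> [//|d'] b d3 /andP[b2 bd]; have b_lt : (b < d'.+1)%N by [].
have b_le := ltnW b_lt.
have b0 : 0 < (b%:R : R) by rewrite ltr0n ltnW.
have alpha1 : 1 < (d'.+1%:R / b%:R : R) by rewrite ltr_pdivlMr// mul1r ltr_nat.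
split.
  rewrite alpha1 ltr_pdivrMr//= -[ltLHS]mulr1 ltr_pM2l ?ltr1n// ltr0n//.
have Ey : (fun n => #|` edges d' b n|%fset) @ \oo --> \oo.
  apply/cvgnyPge => A; near=> n; rewrite card_edges//.
  apply: (@leq_trans n.+1).
    by rewrite ltnW// ltnS; near: n; exact: nbhs_infty_ge.
  rewrite -[leqLHS]mul1n leq_mul ?fact_gt0// -[leqLHS]expn1.
  by rewrite leq_pexp2l.
have dimE := @edges_dimension d' b b2 b_le R b_lt.
exists (vertex_type d' : choiceType), (vertices d' b), (edges d' b).
split; first by move=> n; rewrite -cardfs_gt0 card_vertices// muln_gt0/= expn_gt0.
split.
  apply/cvgnyPge => A; near=> n; rewrite card_vertices//.
  apply: (@leq_trans n.+1).
    by rewrite ltnW// ltnS; near: n; exact: nbhs_infty_ge.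
  rewrite -[leqLHS]mul1n leq_mul// -[leqLHS]expn1.
  by rewrite leq_pexp2l// ltnW.
split; first by move=> n; exact: in_power_edges.
split; first by move=> n; exact: symmetric_edges.
split; first by move=> n; exact: non_diagonal_edges.
split; first exact: Ey.
split; first exact: dimE.
move=> disp Omega P X iid; split.
  exact: superlinear_irreducible Ey dimE alpha1.
exact: edges_clt.
Unshelve. all: by end_near. Qed.
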